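(* Let $A$ be a separable $C^{*}$-algebra that is weakly projective with respect to unital $C^{*}$-algebras. Then $A$ is residually finite dimensional.
   Context: A separable $C^{*}$-algebra $A$ is weakly projective with respect to unital $C^{*}$-algebras if, for every $*$-homomorphism $\varphi:A\rightarrow C$ (not assumed to preserve any unit) and every unital surjective $*$-homomorphism $\rho:B\rightarrow C$ between unital $C^{*}$-algebras $B$ and $C$, there is a sequence $\varphi_{n}:A\rightarrow B$ of $*$-homomorphisms so that $\rho\circ\varphi_{n}\rightarrow\varphi$, meaning $\lim_{n\to\infty}\|\rho(\varphi_{n}(a))-\varphi(a)\|=0$ for each $a\in A$. Separability is part of this definition. A $C^{*}$-algebra is residually finite dimensional (RFD) if it has a separating family of finite dimensional representations, i.e. for every nonzero $a\in A$ there is a $*$-homomorphism $\pi$ from $A$ to the bounded operators on some finite dimensional Hilbert space with $\pi(a)\neq 0$. *)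

(* Defs.v *)
From HB Require Import structures.
From mathcomp Require Import all_boot all_order all_algebra.
From mathcomp Require Import complex.
From mathcomp Require Import all_classical all_reals all_analysis.

Set Implicit Arguments.
Unset Strict Implicit.
Unset Printing Implicit Defensive.

Import Order.TTheory GRing.Theory Num.Theory.
Import numFieldNormedType.Exports.

Local Open Scope classical_set_scope.
Local Open Scope complex_scope.
Local Open Scope ring_scope.

(* Complex C*-algebras, not assumed unital, with complex scalars R[i].
   The multiplication is a separate operation [cmul] because the ring
   structures of the algebra hierarchy all contain a unit.  As for every normed
   module over R[i], the norm `|x| takes its values in R[i]; being
   nonnegative, it is real. *)
HB.mixin Record isCStarAlgebra (R : realType) A
    & CompleteNormedModule R[i] A := {
  cmul : A -> A -> A ;
  cstar : A -> A ;
  cmulA : associative cmul ;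
  cmulDl : left_distributive cmul +%R ;
  cmulDr : right_distributive cmul +%R ;
  cmulZl : forall (k : R[i]) (x y : A), cmul (k *: x) y = k *: cmul x y ;
  cmulZr : forall (k : R[i]) (x y : A), cmul x (k *: y) = k *: cmul x y ;
  cstarD : {morph cstar : x y / x + y} ;
  cstarZ : forall (k : R[i]) (x : A), cstar (k *: x) = (k^*)%R *: cstar x ;
  cstarM : forall x y : A, cstar (cmul x y) = cmul (cstar y) (cstar x) ;
  cstarK : involutive cstar ;
  cnormM_le : forall x y : A, `|cmul x y| <= `|x| * `|y| ;
  cnorm_cstar : forall x : A, `|cmul (cstar x) x| = `|x| ^+ 2
}.

#[short(type="cstarAlgType")]
HB.structure Definition CStarAlgebra (R : realType) :=
  { A of CompleteNormedModule R[i] A & isCStarAlgebra R A }.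

(* The unit is not required to be nonzero, so the zero algebra is unital. *)
HB.mixin Record CStarAlgebra_isUnital (R : realType) A
    & CStarAlgebra R A := {
  cone : A ;
  cmul1l : left_id cone cmul ;
  cmul1r : right_id cone cmul
}.

#[short(type="unitalCStarAlgType")]
HB.structure Definition UnitalCStarAlgebra (R : realType) :=
  { A of CStarAlgebra R A & CStarAlgebra_isUnital R A }.

Record star_hom (R : realType) (A B : cstarAlgType R) (f : A -> B) : Prop := {
  star_hom_linear : linear f ;
  star_homM : forall x y : A, f (cmul x y) = cmul (f x) (f y) ;
  star_hom_star : forall x : A, f (cstar x) = cstar (f x)
}.

Record unital_star_hom (R : realType) (A B : unitalCStarAlgType R)
    (f : A -> B) : Prop := {
  unital_star_hom_hom : star_hom f ;
  unital_star_hom1 : f cone = cone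
}.

Definition separable (T : topologicalType) : Prop :=
  exists D : set T, countable D /\ dense D.

Definition weakly_projective_unital (R : realType) (A : cstarAlgType R) : Prop :=
  separable A /\
  forall (B C : unitalCStarAlgType R) (phi : A -> C) (rho : B -> C),
    star_hom phi ->
    unital_star_hom rho ->
    (forall c : C, exists b : B, rho b = c) ->
    exists phi_ : nat -> A -> B,
      (forall n, star_hom (phi_ n)) /\
      (forall a : A,
         (fun n => `|rho (phi_ n a) - phi a| : R[i]^o) @ \oo --> (0 : R[i]^o)).

(* A finite-dimensional Hilbert space is a finite-dimensional complex vector
   space H with an inner product [ip], linear in its first argument; all its
   linear endomorphisms are bounded, so they form the algebra 'End(H).
   [fd_rep_adj] says that pi (cstar a) is the adjoint of pi a for [ip]. *)
Record fd_representation (R : realType) (A : cstarAlgType R)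
    (H : vectType R[i]) (ip : {dot H for (@Num.conj R[i])})
    (pi : A -> 'End(H)) : Prop := {
  fd_rep_linear : linear pi ;
  fd_repM : forall a b : A, pi (cmul a b) = (pi a \o pi b)%VF ;
  fd_rep_adj : forall (a : A) (u v : H),
    ip (pi a u) v = ip u (pi (cstar a) v)
}.

Definition residually_finite_dimensional (R : realType) (A : cstarAlgType R)
    : Prop :=
  forall a : A, a != 0 ->
    exists (H : vectType R[i]) (ip : {dot H for (@Num.conj R[i])})
      (pi : A -> 'End(H)),
      fd_representation ip pi /\ pi a != 0.

(* Main.v *)
Require Import Defs.
From HB Require Import structures.
From mathcomp Require Import all_boot all_order all_algebra.
From mathcomp Require Import complex.
From mathcomp Require Import all_classical all_reals all_analysis.
From mathcomp Require Import ring lra.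

Set Implicit Arguments.
Unset Strict Implicit.
Unset Printing Implicit Defensive.

Import Order.TTheory GRing.Theory Num.Theory.
Import numFieldNormedType.Exports.

Local Open Scope classical_set_scope.
Local Open Scope complex_scope.
Local Open Scope ring_scope.

(** A weakly projective algebra lifts approximately through every unital
    surjection, so it is enough to map [A] into a unital algebra [C] that is a
    quotient of a residually finite-dimensional one.  Truncation provides the
    quotient.  Let [C] act on a Hilbert space and let [p_s] run through the
    projections on finite-dimensional subspaces; the bounded families of
    operators [T_s] on the ranges of the [p_s] that converge *-strongly to
    some element of [C] form a C*-algebra [B], the limit is a unital
    *-homomorphism from [B] to [C], and it is onto because [p_s c p_s] tends to
    [c].  Every coordinate [T_s] is a finite-dimensional representation of [B].
    If [phi_n] from [A] to [B] lifts the inclusion approximately and [a] is not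
    zero, the limit of [phi_n a] is close to [a], hence not zero for large [n],
    and then some coordinate of [phi_n a] is not zero.

    The proof is arranged so that neither the Hilbert space nor the algebra of
    its operators has to be constructed.  [C] is the unitization of [A]
    ([unitization]).  The Hilbert space is replaced by [C] itself with the
    semi-inner product [<x, y> = F (y* x)] of a positive functional [F], on
    which [C] acts by left multiplication, and an element of [B] is a pair
    consisting of a family of matrices and its limit in [C] ([strong_alg]).
    The index [s] runs through the finite lists of elements of [C]:
    Gram-Schmidt gives a finite-dimensional space that captures the elements of
    [s] ([compression_exists]), and lists are directed under inclusion.
    Convergence is tested on the coordinate vectors of each fixed [v] in [C],
    which makes [B] complete ([strong_complete]) and makes the truncation of
    left multiplication by [c] convergent to [c], with exact equality as soon
    as [v] is in [s] ([compress_lim]).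

    What remains is the heart of the Gelfand-Naimark theorem, the existence of
    positive functionals ([positive_functional_separates]).  It rests on two
    facts about a unital C*-algebra.  The first is that an element [h] with
    [h* = h] and [||t - h|| <= t] for some [t >= 0] has a square root of the
    same kind ([psd_sqrt]), obtained from an iteration that converges in norm
    on the closed unit ball ([sqrt_one_sub]).  Such elements visibly form a
    cone, and square roots alone show that the cone is pointed
    ([psd_eq0]), bounds the norm ([psd_bound]) and contains every [a* a]
    ([psd_cstarM]).  The second is the Hahn-Banach theorem, applied to
    the upper spectral bound [upper_gauge]. *)

(** * Real-valued norms *)

Section RealScalars.
Variable R : realType.
Implicit Types (a b : R) (z : R[i]).

Lemma RRe z : z \is Num.real -> (complex.Re z)%:C = z.
Proof. exact: RRe_real. Qed.

Lemma C_le a b : (a%:C <= b%:C) = (a <= b).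
Proof. exact: lecR. Qed.

Lemma C_lt a b : (a%:C < b%:C) = (a < b).
Proof. exact: ltcR. Qed.

Lemma C0_le a : (0 <= a%:C) = (0 <= a).
Proof. exact: ler0c. Qed.

Lemma C_D a b : (a + b)%:C = a%:C + b%:C.
Proof. exact: rmorphD. Qed.

Lemma C_M a b : (a * b)%:C = a%:C * b%:C.
Proof. exact: rmorphM. Qed.

Lemma C_N a : (- a)%:C = - a%:C.
Proof. exact: rmorphN. Qed.

Lemma C_inj a b : a%:C = b%:C -> a = b.
Proof. exact: complexI. Qed.

Definition cabs z : R := complex.Re `|z|.

Lemma cabsE z : `|z| = (cabs z)%:C.
Proof. by rewrite /cabs RRe// ger0_real. Qed.

Lemma cabs_ge0 z : 0 <= cabs z.
Proof. by rewrite -C0_le -cabsE. Qed.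

Lemma cabs_real a : cabs a%:C = `|a|.
Proof. by rewrite /cabs normc_def/= expr0n/= addr0 sqrtr_sqr. Qed.

Lemma cabs0 : cabs 0 = 0.
Proof. by rewrite (cabs_real 0) normr0. Qed.

Lemma cabs1 : cabs 1 = 1.
Proof. by rewrite (cabs_real 1) normr1. Qed.

Lemma cabs_eq0 z : cabs z = 0 -> z = 0.
Proof. by move=> e; apply/normr0_eq0; rewrite cabsE e. Qed.

Lemma cabsD z z' : cabs (z + z') <= cabs z + cabs z'.
Proof. by rewrite -C_le C_D -!cabsE ler_normD. Qed.

Lemma cabsM z z' : cabs (z * z') = cabs z * cabs z'.
Proof. by apply: C_inj; rewrite C_M -!cabsE normrM. Qed.

Lemma cabsN z : cabs (- z) = cabs z.
Proof. by rewrite /cabs normrN. Qed.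

Lemma cabs_conj z : cabs (z^*)%R = cabs z.
Proof. by rewrite /cabs norm_conjC. Qed.

Lemma cabs_Re z : `|complex.Re z| <= cabs z.
Proof. by rewrite -C_le -cabsE normc_ge_Re. Qed.

Lemma cabs_Im z : `|complex.Im z| <= cabs z.
Proof.
rewrite /cabs normc_def/= -(sqrtr_sqr (complex.Im z)) ler_wsqrtr//.
by rewrite lerDr sqr_ge0.
Qed.

Lemma cabs_le_ReIm z : cabs z <= `|complex.Re z| + `|complex.Im z|.
Proof.
rewrite /cabs normc_def/=; set a := complex.Re z; set b := complex.Im z.
rewrite -(ger0_norm (addr_ge0 (normr_ge0 a) (normr_ge0 b))).
rewrite -sqrtr_sqr ler_wsqrtr// sqrrD !real_normK ?num_real//.
by rewrite lerD2r lerDl mulrn_wge0// mulr_ge0.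
Qed.

Lemma C_conj a : (a%:C^*)%R = a%:C.
Proof. by apply: conj_Creal; apply/complex_realP; exists a. Qed.

Lemma C_nat n : (n%:R : R)%:C = n%:R.
Proof. exact: rmorph_nat. Qed.

End RealScalars.

Definition nrm (R : realType) (V : normedModType R[i]) (x : V) : R :=
  complex.Re `|x|.

Section RealNorm.
Variables (R : realType) (V : normedModType R[i]).
Implicit Types (x y : V) (r : R) (k : R[i]).

Lemma nrmE x : `|x| = (nrm x)%:C.
Proof. by rewrite /nrm RRe// ger0_real. Qed.

Lemma nrm_ge0 x : 0 <= nrm x.
Proof. by rewrite -C0_le -nrmE. Qed.

Lemma nrm_eq0 x : nrm x = 0 -> x = 0.
Proof. by move=> e; apply/normr0_eq0; rewrite nrmE e. Qed.

Lemma nrm0 : nrm (0 : V) = 0.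
Proof. by rewrite /nrm normr0. Qed.

Lemma nrmD x y : nrm (x + y) <= nrm x + nrm y.
Proof. by rewrite -C_le C_D -!nrmE ler_normD. Qed.

Lemma nrmN x : nrm (- x) = nrm x.
Proof. by rewrite /nrm normrN. Qed.

Lemma nrmB x y : nrm (x - y) = nrm (y - x).
Proof. by rewrite -nrmN opprB. Qed.

Lemma nrmZ k x : nrm (k *: x) = cabs k * nrm x.
Proof.
by apply: C_inj; rewrite C_M -!nrmE normrZ cabsE.
Qed.

Lemma nrmZr r x : nrm (r%:C *: x) = `|r| * nrm x.
Proof. by rewrite nrmZ cabs_real. Qed.

Lemma nrm_triangle z x y : nrm (x - y) <= nrm (x - z) + nrm (z - y).
Proof. by rewrite (le_trans _ (nrmD _ _))// addrA subrK. Qed.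

Lemma nrm_small x : (forall e : R, 0 < e -> nrm x <= e) -> x = 0.
Proof.
move=> h; apply: nrm_eq0; apply/eqP; rewrite eq_le nrm_ge0 andbT.
by apply/ler_addgt0Pr => e e0; rewrite add0r h.
Qed.

Lemma nrm_cvgP (u : nat -> V) x :
  u @ \oo --> x <->
  (forall e : R, 0 < e -> exists N, forall n, (N <= n)%N -> nrm (x - u n) <= e).
Proof.
split=> [/cvgrPdist_le ux e e0|ux].
  have e0' : (0 : R[i]) < e%:C by rewrite C_lt.
  have [N _ H] := ux _ e0'.
  by exists N => n /H; rewrite /= nrmE C_le.
apply/cvgrPdist_le => e e0.
have eE : e = (complex.Re e)%:C by rewrite RRe// gtr0_real.
have [|N H] := ux (complex.Re e); first by rewrite -C_lt -eE.
by exists N => // n /H; rewrite nrmE eE C_le.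
Qed.

(** Completeness of a normed space may be tested on Cauchy sequences: in a
    Cauchy filter, balls of radius [1 / (n + 1)] have centers that form one. *)
Lemma complete_of_cauchy_seq :
  (forall u : nat -> V,
    (forall e : R, 0 < e -> exists N, forall m n, (N <= m)%N -> (N <= n)%N ->
       nrm (u m - u n) <= e) ->
    exists x : V, u @ \oo --> x) ->
  forall F : set_system V, ProperFilter F -> cauchy F -> cvg F.
Proof.
move=> seqc F PF /cauchyP cF.
have pos n : 0 < (n.+1%:R^-1 : R) by rewrite invr_gt0.
have cs n : exists x : V, F (ball x (n.+1%:R^-1 : R)%:C).
  by apply: cF; rewrite C_lt.
pose u n := projT1 (cid (cs n)).
have Fu n : F (ball (u n) (n.+1%:R^-1 : R)%:C) := projT2 (cid (cs n)).
have uE m n : nrm (u m - u n) <= m.+1%:R^-1 + n.+1%:R^-1.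
  have [z [zm zn]] := filter_ex (filterI (Fu m) (Fu n)).
  apply: (le_trans (nrm_triangle z _ _)).
  move: zm zn; rewrite -!ball_normE /ball_/= !nrmE !C_lt => zm zn.
  by rewrite lerD// ltW// nrmB.
have arch (e : R) : 0 < e -> exists N, forall n, (N <= n)%N -> n.+1%:R^-1 <= e.
  move=> e0; exists (Num.truncn e^-1) => n Nn.
  rewrite invf_ple ?posrE// ltW// (lt_le_trans (truncnS_gt _))// ler_nat.
  by rewrite ltnS.
have [|x /nrm_cvgP ux] := seqc u.
  move=> e e0; have [|N HN] := arch (e / 2); first by rewrite divr_gt0.
  exists N => m n /HN hm /HN hn; rewrite (le_trans (uE m n))//.
  by rewrite (splitr e) lerD.
apply/cvg_ex; exists x; apply/cvgrPdist_le => e e0.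
have eE : e = (complex.Re e)%:C by rewrite RRe// gtr0_real.
set r := complex.Re e in eE; have r0 : 0 < r by rewrite -C_lt -eE.
have [|N HN] := ux (r / 2); first by rewrite divr_gt0.
have [|M HM] := arch (r / 2); first by rewrite divr_gt0.
pose n := maxn N M.
apply: filterS (Fu n) => z; rewrite -ball_normE /ball_/= eE !nrmE C_lt C_le => zn.
rewrite (le_trans (nrm_triangle (u n) _ _))// (splitr r) lerD//.
  by rewrite HN// leq_maxl.
by rewrite (le_trans (ltW zn))// HM// leq_maxr.
Qed.

End RealNorm.

Lemma cauchy_seq_cvg (R : realType) (V : completeNormedModType R[i])
    (u : nat -> V) :
  (forall e : R, 0 < e -> exists N, forall m n, (N <= m)%N -> (N <= n)%N ->
     nrm (u m - u n) <= e) ->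
  exists x : V, u @ \oo --> x.
Proof.
move=> cu.
suff h : cauchy (u @ \oo) by apply/cvg_ex; exact: cauchy_cvg h.
apply: (@cauchy_exP R[i] V) => e e0.
have eE : e = (complex.Re e)%:C by rewrite RRe// gtr0_real.
set r := complex.Re e in eE; have r0 : 0 < r by rewrite -C_lt -eE.
have [|N HN] := cu (r / 2); first by rewrite divr_gt0.
exists (u N); exists N => // n /= Nn.
rewrite -ball_normE /ball_/= nrmE eE C_lt (le_lt_trans (HN _ _ _ Nn))//.
by rewrite ltr_pdivrMr// ltr_pMr// ltrDl.
Qed.

Lemma real_cauchy_seq_cvg (R : realType) (u : nat -> R) :
  (forall e : R, 0 < e -> exists N, forall m n, (N <= m)%N -> (N <= n)%N ->
     `|u m - u n| <= e) ->
  exists l, forall e : R, 0 < e -> exists N, forall n, (N <= n)%N ->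
    `|l - u n| <= e.
Proof.
move=> cu; suff h : cauchy (u @ \oo).
  have /cvg_ex[l /cvgrPdist_le ul] : cvg (u @ \oo) by exact: cauchy_cvg h.
  by exists l => e /ul[N _ HN]; exists N => n /HN.
apply: (@cauchy_exP R R) => e e0.
have [|N HN] := cu (e / 2); first by rewrite divr_gt0.
exists (u N); exists N => // n /= Nn.
rewrite -ball_normE /ball_/= (le_lt_trans (HN _ _ _ Nn))//.
by rewrite ltr_pdivrMr// ltr_pMr// ltrDl.
Qed.

(** Real and imaginary parts are Cauchy sequences in the complete field [R]. *)
Lemma complex_cauchy_seq_cvg (R : realType) (u : nat -> R[i]) :
  (forall e : R, 0 < e -> exists N, forall m n, (N <= m)%N -> (N <= n)%N ->
     cabs (u m - u n) <= e) ->
  exists l, forall e : R, 0 < e -> exists N, forall n, (N <= n)%N ->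
    cabs (l - u n) <= e.
Proof.
move=> cu.
have [|a Ha] := @real_cauchy_seq_cvg R (fun n => complex.Re (u n)).
  move=> e /cu[N HN]; exists N => m n hm hn.
  by rewrite -raddfB (le_trans (cabs_Re _))// HN.
have [|b Hb] := @real_cauchy_seq_cvg R (fun n => complex.Im (u n)).
  move=> e /cu[N HN]; exists N => m n hm hn.
  by rewrite -raddfB (le_trans (cabs_Im _))// HN.
exists (a +i* b) => e e0.
have [|N HN] := Ha (e / 2); first by rewrite divr_gt0.
have [|M HM] := Hb (e / 2); first by rewrite divr_gt0.
exists (maxn N M) => n; rewrite geq_max => /andP[/HN h1 /HM h2].
rewrite (le_trans (cabs_le_ReIm _))// (splitr e) !raddfB/=.
exact: lerD.
Qed.

(** * Positive elements of a C*-algebra *)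

Notation "x ** y" := (cmul x y) (at level 40, left associativity).

Section CStarBasics.
Variables (R : realType) (A : cstarAlgType R).
Implicit Types (x y z a b h : A) (r t : R).

Lemma cmul0l x : 0 ** x = 0.
Proof. by apply: (addrI (0 ** x)); rewrite -cmulDl !addr0. Qed.

Lemma cmul0r x : x ** 0 = 0.
Proof. by apply: (addrI (x ** 0)); rewrite -cmulDr !addr0. Qed.

Lemma cmulNl x y : (- x) ** y = - (x ** y).
Proof. by rewrite -scaleN1r cmulZl scaleN1r. Qed.

Lemma cmulNr x y : x ** (- y) = - (x ** y).
Proof. by rewrite -scaleN1r cmulZr scaleN1r. Qed.

Lemma cmulBl x y z : (x - y) ** z = x ** z - y ** z.
Proof. by rewrite cmulDl cmulNl. Qed.

Lemma cmulBr x y z : z ** (x - y) = z ** x - z ** y.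
Proof. by rewrite cmulDr cmulNr. Qed.

Lemma cstar0 : cstar 0 = 0 :> A.
Proof. by apply: (addrI (cstar 0)); rewrite -cstarD !addr0. Qed.

Lemma cstarN x : cstar (- x) = - cstar x.
Proof. by apply: (addrI (cstar x)); rewrite -cstarD !subrr cstar0. Qed.

Lemma cstarB x y : cstar (x - y) = cstar x - cstar y.
Proof. by rewrite cstarD cstarN. Qed.

Lemma cstarZr r x : cstar (r%:C *: x) = r%:C *: cstar x.
Proof. by rewrite cstarZ C_conj. Qed.

Lemma cstar_i x : cstar ('i *: x) = - ('i *: cstar x).
Proof.
by rewrite cstarZ -[('i : R[i])^*%R]/(('i)^* : R[i])%R conjCi scaleNr.
Qed.

Lemma nrmM x y : nrm (x ** y) <= nrm x * nrm y.
Proof. by rewrite -C_le C_M -!nrmE cnormM_le. Qed.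

Lemma nrm_cstarM x : nrm (cstar x ** x) = nrm x ^+ 2.
Proof. by apply: C_inj; rewrite expr2 C_M -!nrmE cnorm_cstar expr2. Qed.

(** From [||x||^2 = ||x* x|| <= ||x*|| ||x||]. *)
Lemma nrm_cstar x : nrm (cstar x) = nrm x.
Proof.
have le y : nrm y <= nrm (cstar y).
  have [->|y0] := eqVneq y 0; first by rewrite nrm0 nrm_ge0.
  have p : 0 < nrm y.
    by rewrite lt_neqAle nrm_ge0 andbT eq_sym; apply: contra_neq y0 => /nrm_eq0.
  by rewrite -(ler_pM2r p) -expr2 -nrm_cstarM nrmM.
by apply/eqP; rewrite eq_le le andbT -{2}(cstarK x) le.
Qed.

Lemma nrm_herm_sqr h : cstar h = h -> nrm (h ** h) = nrm h ^+ 2.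
Proof. by move=> {1}<-; exact: nrm_cstarM. Qed.

Lemma herm_sqr_eq0 h : cstar h = h -> h ** h = 0 -> h = 0.
Proof.
move=> hh h0; apply/nrm_eq0/eqP.
by rewrite -sqrf_eq0 -nrm_herm_sqr// h0 nrm0.
Qed.

Lemma cvg_cmul (u v : nat -> A) x y :
  u @ \oo --> x -> v @ \oo --> y -> (fun n => u n ** v n) @ \oo --> x ** y.
Proof.
move=> /nrm_cvgP ux /nrm_cvgP vy; apply/nrm_cvgP => e e0.
pose K := nrm x + nrm y + 1.
have K0 : 0 < K by rewrite ltr_wpDl// addr_ge0 ?nrm_ge0.
pose d := Num.min 1 (e / (2 * K)).
have d0 : 0 < d by rewrite lt_min ltr01 divr_gt0// mulr_gt0.
have [N HN] := ux _ d0; have [M HM] := vy _ d0.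
exists (maxn N M) => n; rewrite geq_max => /andP[/HN hx /HM hy].
have -> : x ** y - u n ** v n = x ** (y - v n) + (x - u n) ** v n.
  by rewrite cmulBr cmulBl addrA subrK.
have d1 : d <= 1 by rewrite ge_min lexx.
have vK : nrm (v n) <= nrm y + 1.
  have := nrmD y (v n - y); rewrite addrC subrK => /le_trans; apply.
  by rewrite lerD2l nrmB (le_trans hy).
rewrite (le_trans (nrmD _ _))//.
have h1 : nrm (x ** (y - v n)) <= K * d.
  rewrite (le_trans (nrmM _ _))// ler_pM ?nrm_ge0//.
  by rewrite /K -addrA lerDl addr_ge0 ?nrm_ge0.
have h2 : nrm ((x - u n) ** v n) <= K * d.
  rewrite (le_trans (nrmM _ _))// mulrC ler_pM ?nrm_ge0// (le_trans vK)//.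
  by rewrite /K -addrA lerDr nrm_ge0.
rewrite (le_trans (lerD h1 h2))// -mulr2n -mulrnAl.
have : d <= e / (2 * K) by rewrite ge_min lexx orbT.
by rewrite ler_pdivlMr ?mulr_gt0// mulrC mulr_natl.
Qed.

Lemma cvg_cstar (u : nat -> A) x :
  u @ \oo --> x -> (fun n => cstar (u n)) @ \oo --> cstar x.
Proof.
move=> /nrm_cvgP ux; apply/nrm_cvgP => e /ux[N HN].
by exists N => n /HN; rewrite -cstarB nrm_cstar.
Qed.

End CStarBasics.

Lemma nrm_cvg_le (R : realType) (V : normedModType R[i]) (u : nat -> V) (x : V) r :
  u @ \oo --> x -> (forall n, nrm (u n) <= r) -> nrm x <= r.
Proof.
move=> /nrm_cvgP ux ur; apply/ler_addgt0Pr => e /ux[N HN].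
have := nrmD (x - u N) (u N); rewrite subrK addrC => /le_trans; apply.
by rewrite lerD// HN.
Qed.

Lemma cvg_unique_seq (R : realType) (V : normedModType R[i]) (u : nat -> V) (x y : V) :
  u @ \oo --> x -> u @ \oo --> y -> x = y.
Proof. by move=> ux uy; apply: (cvg_unique _ ux uy). Qed.

Section SquareRoot.
Variables (R : realType) (A : unitalCStarAlgType R).
Implicit Types (x y z a b h : A) (r t : R).
Notation one := (@cone R A).

Lemma cstar1 : cstar one = one.
Proof. by rewrite -{2}(cstarK one) -{2}(cmul1l (cstar one)) cstarM cstarK cmul1l. Qed.

Lemma nrm1_le1 : nrm one <= 1.
Proof.
have : nrm one ^+ 2 = nrm one by rewrite -nrm_cstarM cstar1 cmul1l.
move=> /eqP; rewrite expr2 -subr_eq0 -{3}(mulr1 (nrm one)) -mulrBr mulf_eq0.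
by case/orP => [/eqP->//|]; rewrite subr_eq0 => /eqP->.
Qed.

(** The iteration [y = (x + y^2) / 2] starting from 0; its limit is
    [1 - sqrt (1 - x)].  Run on the number 1 it increases to at most 1, and
    those numbers dominate the norms of the increments for all [x] in the unit
    ball, including its boundary. *)
Fixpoint sqrt_iter (x : A) (n : nat) : A :=
  if n is m.+1 then (2^-1 : R)%:C *: (x + sqrt_iter x m ** sqrt_iter x m) else 0.

Fixpoint sqrt_bound (n : nat) : R :=
  if n is m.+1 then 2^-1 * (1 + sqrt_bound m ^+ 2) else 0.

Lemma sqrt_bound_itv n : 0 <= sqrt_bound n <= 1.
Proof.
elim: n => [|n /andP[h0 h1]] /=; first by rewrite lexx ler01.
have : sqrt_bound n ^+ 2 <= 1 by rewrite expr_le1.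
by have := sqr_ge0 (sqrt_bound n); lra.
Qed.

Lemma sqrt_bound_nd : {homo sqrt_bound : m n / (m <= n)%N >-> m <= n}.
Proof.
apply: homo_leq => // [|n]; first exact: le_trans.
by rewrite /=; have := sqr_ge0 (1 - sqrt_bound n); rewrite sqrrB; lra.
Qed.

Lemma nrm_half x : nrm ((2^-1 : R)%:C *: x) = 2^-1 * nrm x.
Proof. by rewrite nrmZr ger0_norm// invr_ge0. Qed.

Section Iteration.
Variables (x : A) (x1 : nrm x <= 1).

Lemma nrm_sqrt_iter n : nrm (sqrt_iter x n) <= sqrt_bound n.
Proof.
elim: n => [|n IHn] /=; first by rewrite nrm0.
rewrite nrm_half ler_pM2l ?invr_gt0// (le_trans (nrmD _ _))// lerD//.
by rewrite (le_trans (nrmM _ _))// expr2 ler_pM ?nrm_ge0.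
Qed.

Lemma nrm_sqrt_iterS n :
  nrm (sqrt_iter x n.+1 - sqrt_iter x n) <= sqrt_bound n.+1 - sqrt_bound n.
Proof.
elim: n => [|n IHn].
  by rewrite /= !subr0 cmul0l addr0 nrm_half expr0n/= addr0 ler_pM2l ?invr_gt0.
set a := sqrt_iter x n.+1 in IHn *; set b := sqrt_iter x n in IHn *.
have -> : sqrt_iter x n.+2 - a = (2^-1 : R)%:C *: (a ** (a - b) + (a - b) ** b).
  rewrite -[LHS]/((2^-1 : R)%:C *: (x + a ** a) - (2^-1 : R)%:C *: (x + b ** b)).
  by rewrite -scalerBr cmulBr cmulBl addrA subrK opprD addrACA subrr add0r.
rewrite nrm_half.
have ha : nrm a <= sqrt_bound n.+1 := nrm_sqrt_iter n.+1.
have hb : nrm b <= sqrt_bound n := nrm_sqrt_iter n.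
have -> : sqrt_bound n.+2 - sqrt_bound n.+1 = 2^-1 *
  (sqrt_bound n.+1 * (sqrt_bound n.+1 - sqrt_bound n) +
   (sqrt_bound n.+1 - sqrt_bound n) * sqrt_bound n) by rewrite /=; ring.
rewrite ler_pM2l ?invr_gt0// (le_trans (nrmD _ _))// lerD//.
  by rewrite (le_trans (nrmM _ _))// ler_pM ?nrm_ge0.
by rewrite (le_trans (nrmM _ _))// ler_pM ?nrm_ge0.
Qed.

Lemma nrm_sqrt_iterB m n : (n <= m)%N ->
  nrm (sqrt_iter x m - sqrt_iter x n) <= sqrt_bound m - sqrt_bound n.
Proof.
move=> /subnK <-; elim: (m - n)%N => [|k IHk]; first by rewrite add0n !subrr nrm0.
rewrite addSn (le_trans (nrm_triangle (sqrt_iter x (k + n)) _ _))//.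
by have := nrm_sqrt_iterS (k + n); move: IHk; lra.
Qed.

Lemma sqrt_iter_cvg : exists y : A, sqrt_iter x @ \oo --> y.
Proof.
apply: cauchy_seq_cvg => e e0.
have /cvgrPdist_le cv : sqrt_bound @ \oo --> sup (range sqrt_bound).
  apply: nondecreasing_cvgn; first exact: sqrt_bound_nd.
  by exists 1 => _ [n _ <-]; have /andP[] := sqrt_bound_itv n.
have [|N _ HN] := cv (e / 2); first by rewrite divr_gt0.
have main m n : (N <= n)%N -> (n <= m)%N ->
    nrm (sqrt_iter x m - sqrt_iter x n) <= e.
  move=> Nn nm; rewrite (le_trans (nrm_sqrt_iterB nm))//.
  have := HN _ Nn; have := HN _ (leq_trans Nn nm).
  by rewrite /= !ler_distl => /andP[? ?] /andP[? ?]; lra.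
exists N => m n Nm Nn; have [nm|mn] := leqP n m; first exact: main.
by rewrite nrmB; apply: main => //; exact: ltnW.
Qed.

(** Besides solving the equation, this root is hermitian when [x] is, and
    commutes with whatever commutes with [x]: both pass to the limit. *)
Lemma sqrt_one_sub : exists y,
  [/\ nrm y <= 1, (one - y) ** (one - y) = one - x,
      cstar x = x -> cstar y = y
    & forall z, z ** x = x ** z -> z ** y = y ** z].
Proof.
have [y cy] := sqrt_iter_cvg; exists y.
have eqy : y + y = x + y ** y.
  have c1 : (fun n => sqrt_iter x n.+1) @ \oo --> y.
    by rewrite (cvg_shiftS (sqrt_iter x)).
  have c2 : (fun n => sqrt_iter x n.+1) @ \oo --> (2^-1 : R)%:C *: (x + y ** y).
    by apply: cvgZr => /=; apply: cvgD; [exact: cvg_cst | exact: cvg_cmul].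
  rewrite {1 2}(cvg_unique_seq c1 c2) -scalerDl -C_D.
  by rewrite (_ : 2^-1 + 2^-1 = 1 :> R) ?scale1r//; field.
split.
- apply: nrm_cvg_le cy _ => n.
  by rewrite (le_trans (nrm_sqrt_iter n))//; have /andP[] := sqrt_bound_itv n.
- rewrite cmulBl !cmulBr !cmul1l cmul1r opprB addrA addrAC -(addrA one) -opprD eqy.
  by rewrite opprD addrA subrK.
- move=> hx; apply: (cvg_unique_seq (cvg_cstar cy)).
  rewrite (_ : (fun n => _) = sqrt_iter x)//; apply/funext.
  elim=> [|n IHn] /=; first by rewrite cstar0.
  by rewrite cstarZr cstarD cstarM hx IHn.
- move=> z zx.
  have c1 : (fun n => z ** sqrt_iter x n) @ \oo --> z ** y.
    exact: cvg_cmul (cvg_cst _) cy.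
  have c2 : (fun n => sqrt_iter x n ** z) @ \oo --> y ** z.
    exact: cvg_cmul cy (cvg_cst _).
  apply: (cvg_unique_seq c1); rewrite (_ : (fun n => _) = fun n => sqrt_iter x n ** z)//.
  apply/funext; elim=> [|n IHn] /=; first by rewrite cmul0l cmul0r.
  by rewrite cmulZr cmulZl cmulDr cmulDl zx cmulA IHn -!cmulA IHn.
Qed.

End Iteration.

End SquareRoot.

Section Positivity.
Variables (R : realType) (A : unitalCStarAlgType R).
Implicit Types (x y z a b h u v w : A) (r t : R).
Notation one := (@cone R A).

(** Positivity by the norm: the spectrum of a hermitian [h] lies in [[0, 2 t]]
    exactly when [||t - h|| <= t].  In this form sums are immediate. *)
Definition psd h :=
  cstar h = h /\ exists2 t : R, 0 <= t & nrm (t%:C *: one - h) <= t.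

Lemma cstar_real t : cstar (t%:C *: one) = t%:C *: one.
Proof. by rewrite cstarZr cstar1. Qed.

Lemma cmul_reall t x : (t%:C *: one) ** x = t%:C *: x.
Proof. by rewrite cmulZl cmul1l. Qed.

Lemma cmul_realr t x : x ** (t%:C *: one) = t%:C *: x.
Proof. by rewrite cmulZr cmul1r. Qed.

Lemma comm_realD t x z :
  z ** x = x ** z -> z ** (t%:C *: one + x) = (t%:C *: one + x) ** z.
Proof. by move=> zx; rewrite cmulDl cmulDr cmul_reall cmul_realr zx. Qed.

Lemma comm_realB t x z :
  z ** x = x ** z -> z ** (t%:C *: one - x) = (t%:C *: one - x) ** z.
Proof. by move=> zx; apply: comm_realD; rewrite cmulNl cmulNr zx. Qed.

Lemma nrm_real t : 0 <= t -> nrm (t%:C *: one) <= t.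
Proof.
by move=> t0; rewrite nrmZr ger0_norm// ler_piMr// nrm1_le1.
Qed.

Lemma psd_real t : 0 <= t -> psd (t%:C *: one).
Proof.
by move=> t0; split; [exact: cstar_real | exists t; rewrite // subrr nrm0].
Qed.

Lemma psd_sub_real h t : cstar h = h -> nrm h <= t -> psd (t%:C *: one - h).
Proof.
move=> hh ht; split; first by rewrite cstarB hh cstar_real.
by exists t; [exact: le_trans (nrm_ge0 _) ht | rewrite opprB addrC subrK].
Qed.

Lemma psd_add_real h t : cstar h = h -> nrm h <= t -> psd (t%:C *: one + h).
Proof.
by move=> hh ht; rewrite -(opprK h); apply: psd_sub_real; rewrite ?cstarN ?hh ?nrmN.
Qed.

Lemma psdD h u : psd h -> psd u -> psd (h + u).
Proof.
move=> [hh [t t0 ht]] [hu [s s0 us]]; split; first by rewrite cstarD hh hu.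
exists (t + s); first exact: addr_ge0.
by rewrite C_D scalerDl opprD addrACA (le_trans (nrmD _ _))// lerD.
Qed.

Lemma psdZ r h : 0 <= r -> psd h -> psd (r%:C *: h).
Proof.
move=> r0 [hh [t t0 ht]]; split; first by rewrite cstarZr hh.
exists (r * t); first exact: mulr_ge0.
by rewrite C_M -scalerA -scalerBr nrmZr ger0_norm// ler_wpM2l.
Qed.

(** Rescaled to [t = 1], this is the root of [1 - x] with [x = 1 - h].  The
    commutation clause replaces the functional calculus below: roots of
    commuting elements commute. *)
Lemma psd_sqrt h : psd h ->
  exists s, [/\ psd s, s ** s = h & forall z, z ** h = h ** z -> z ** s = s ** z].
Proof.
move=> [hh [t t0 ht]]; have [t00|tN0] := eqVneq t 0.
  have -> : h = 0.
    apply: nrm_eq0; apply/eqP; rewrite eq_le nrm_ge0 andbT.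
    by move: ht; rewrite t00 scale0r sub0r nrmN.
  exists 0; split; [|exact: cmul0l|by move=> z; rewrite cmul0l cmul0r].
  by split; [exact: cstar0|exists 0; rewrite // subr0 scale0r nrm0].
have tp : 0 < t by rewrite lt_neqAle eq_sym tN0.
pose x := one - (t^-1)%:C *: h.
have x1 : nrm x <= 1.
  rewrite -(ler_pM2l tp) mulr1 (le_trans _ ht)// -{1}(ger0_norm t0) -nrmZr.
  by rewrite scalerBr scalerA -C_M mulfV// scale1r.
have [y [y1 yy hy cy]] := sqrt_one_sub x1.
exists ((Num.sqrt t)%:C *: (one - y)); split.
- split.
    rewrite cstarZr cstarB cstar1 hy// /x cstarB cstar1 cstarZr hh//.
  exists (Num.sqrt t); first exact: sqrtr_ge0.
  rewrite -scalerBr opprB addrC subrK nrmZr ger0_norm ?sqrtr_ge0//.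
  by rewrite ler_piMr// sqrtr_ge0.
- rewrite cmulZl cmulZr scalerA -C_M yy -expr2 sqr_sqrtr// /x opprB addrC subrK.
  by rewrite scalerA -C_M mulfV// scale1r.
- move=> z zh; rewrite cmulZl cmulZr; congr (_ *: _).
  rewrite cmulBl cmulBr cmul1l cmul1r cy// /x cmulBl cmulBr cmul1l cmul1r.
  by rewrite cmulZl cmulZr zh.
Qed.

(** [a + i s] is then [sqrt t] times an isometry, and its real part is [a]. *)
Lemma herm_pythagoras a s t : cstar a = a -> cstar s = s -> a ** s = s ** a ->
  a ** a + s ** s = t%:C *: one -> 0 <= t -> nrm a ^+ 2 <= t.
Proof.
move=> ha hs as_sa e t0.
pose U := a + 'i *: s.
have sU : cstar U = a - 'i *: s.
  by rewrite cstarD cstar_i ha hs.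
have nU : nrm U ^+ 2 <= t.
  rewrite -nrm_cstarM sU (_ : _ ** U = t%:C *: one) ?nrm_real//.
  rewrite /U cmulBl !cmulDr !cmulZl !cmulZr as_sa scalerA -expr2 sqrCi scaleN1r.
  by rewrite opprD opprK addrA addrK e.
rewrite (le_trans _ nU)// ler_sqr ?nnegrE ?nrm_ge0//.
have : nrm (U + cstar U) <= 2 * nrm U.
  by rewrite (le_trans (nrmD _ _))// nrm_cstar mulr_natl.
rewrite sU /U addrACA subrr addr0 -mulr2n -scaler_nat -C_nat.
by rewrite nrmZr ger0_norm// ler_pM2l.
Qed.

(** With [t = ||a||^2] and [s = sqrt (t - a^2)], the pair [s], [a] is on the
    circle of radius [sqrt t], so [||t - a^2|| = ||s||^2 <= t]. *)
Lemma psd_sqr a : cstar a = a -> psd (a ** a).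
Proof.
move=> ha; have t0 : 0 <= nrm a ^+ 2 := sqr_ge0 _.
have haa : cstar (a ** a) = a ** a by rewrite cstarM ha.
have [|s [[hs _] ss cs]] := psd_sqrt (psd_sub_real haa (t := nrm a ^+ 2) _).
  by rewrite nrm_herm_sqr.
split=> //; exists (nrm a ^+ 2) => //; rewrite -ss nrm_herm_sqr//.
have cas : a ** s = s ** a.
  by apply/cs/comm_realB; rewrite cmulA.
by apply: (@herm_pythagoras s a) => //; rewrite ss subrK.
Qed.

Lemma psdM u v : psd u -> psd v -> u ** v = v ** u -> psd (u ** v).
Proof.
move=> /psd_sqrt[s [[hs _] ss cs]] /psd_sqrt[w [[hw _] ww cw]] uv.
have sv : v ** s = s ** v by exact: cs.
have sw : s ** w = w ** s by apply: cw.
have -> : u ** v = (s ** w) ** (s ** w).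
  by rewrite -ss -ww !cmulA -(cmulA s w s) -sw !cmulA.
by apply: psd_sqr; rewrite cstarM hs hw.
Qed.

(** The product [(t - u) (t + u) = t^2 - u^2] is again positive, so it has a
    root [w] and [u], [w] lie on the circle of radius [t]. *)
Lemma psd_bound u t : 0 <= t -> psd (t%:C *: one - u) -> psd (t%:C *: one + u) ->
  nrm u <= t.
Proof.
move=> t0 pN pP.
have hu : cstar u = u.
  by case: pP => + _; rewrite cstarD cstar_real => /addrI.
have [|w [[hw _] ww cw]] := psd_sqrt (psdM pN pP _).
  by apply: comm_realD; apply/esym/comm_realB.
have {}ww : w ** w = (t ^+ 2)%:C *: one - u ** u.
  rewrite ww cmulBl !cmulDr !(cmul_reall, cmul_realr) scalerA -C_M -expr2.
  by rewrite opprD addrA addrK.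
rewrite -ler_sqr ?nnegrE ?nrm_ge0//.
apply: (@herm_pythagoras u w) => //; rewrite ?sqr_ge0//; last by rewrite ww addrC subrK.
apply: cw; rewrite cmulA (comm_realB _ (erefl (u ** u))) -!cmulA; congr (_ ** _).
exact: comm_realD.
Qed.

Lemma psd_eq0 h : psd h -> psd (- h) -> h = 0.
Proof.
move=> p n; apply/nrm_eq0/eqP; rewrite eq_le nrm_ge0 andbT.
by apply: psd_bound; rewrite // scale0r add0r.
Qed.

(** For [d = b w] one has [d* d = - w^4] and [d d* = - q^2] with [q = b b*],
    yet the sum of the two is, up to a positive factor, the sum of the squares
    of the real and imaginary parts of [d].  So all these squares vanish. *)
Lemma cstarM_neg_sqr b w :
  cstar w = w -> cstar b ** b = - (w ** w) -> w = 0.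
Proof.
move=> hw bb.
pose d := b ** w; pose q := b ** cstar b.
have hq : cstar q = q by rewrite cstarM cstarK.
have sd : cstar d = w ** cstar b by rewrite cstarM hw.
have dd : cstar d ** d = - ((w ** w) ** (w ** w)).
  by rewrite sd /d cmulA -(cmulA w) bb cmulNr cmulNl !cmulA.
have dd' : d ** cstar d = - (q ** q).
  rewrite sd /d /q !cmulA -(cmulA b w w) -(opprK (w ** w)) -bb cmulNr cmulNl.
  by rewrite !cmulA.
have hx : cstar (d + cstar d) = d + cstar d by rewrite cstarD cstarK addrC.
have hy : cstar ('i *: (cstar d - d)) = 'i *: (cstar d - d).
  by rewrite cstar_i cstarB cstarK -scalerN opprB.
have pS : psd (- ((q ** q + (w ** w) ** (w ** w)) + (q ** q + (w ** w) ** (w ** w)))).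
  have := psdD (psd_sqr hx) (psd_sqr hy).
  rewrite cmulZl cmulZr scalerA -expr2 sqrCi scaleN1r.
  set e := cstar d in dd dd' *.
  rewrite cmulBl !cmulBr cmulDl !cmulDr !opprB.
  rewrite addrACA (addrC (d ** d)) (addrACA (d ** e)) subrr addr0.
  rewrite (addrACA (e ** d)) subrr addr0 dd dd' addrACA.
  by rewrite -!opprD.
have pq : psd (q ** q) by exact: psd_sqr.
have pw : psd ((w ** w) ** (w ** w)) by apply: psd_sqr; rewrite cstarM hw.
have pP := psdD pq pw.
have /eqP := psd_eq0 (psdD pP pP) pS.
set P := q ** q + _ in pP *.
rewrite -mulr2n -scaler_nat scaler_eq0 pnatr_eq0/= => /eqP P0.
have qq0 : q ** q = 0.
  apply: psd_eq0 => //; suff -> : - (q ** q) = (w ** w) ** (w ** w) by [].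
  by apply/eqP; rewrite eq_sym -addr_eq0 addrC -/P P0.
have q0 : q = 0 by exact: herm_sqr_eq0.
have b0 : b = 0.
  rewrite -(cstarK b); suff -> : cstar b = 0 by rewrite cstar0.
  apply/nrm_eq0/eqP; rewrite -sqrf_eq0 -nrm_cstarM cstarK.
  by rewrite -/q q0 nrm0.
apply: herm_sqr_eq0 => //.
by apply/eqP; rewrite -oppr_eq0 -bb b0 cmul0r.
Qed.

(** Put [h = a* a], [m = sqrt (h^2)] and [k = m - h], twice the negative part
    of [h].  Then [h k = - m k], so [b = a k] satisfies [b* b = - (k r)^2]
    with [r = sqrt m]; hence [k r = 0], and then [k = 0]. *)
Lemma psd_cstarM a : psd (cstar a ** a).
Proof.
set h := cstar a ** a.
have hh : cstar h = h by rewrite cstarM cstarK.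
have [m [pm mm cm]] := psd_sqrt (psd_sqr hh).
have hm : h ** m = m ** h by apply: cm; rewrite cmulA.
have [r [[hr _] rr cr]] := psd_sqrt pm.
have hm' := pm.1.
pose k := m - h.
have hk : cstar k = k by rewrite cstarB hh hm'.
have kr : k ** r = r ** k by apply: cr; rewrite cmulBl cmulBr hm.
have hkE : h ** k = - (m ** k) by rewrite !cmulBr -mm hm opprB.
have w0 : k ** r = 0.
  apply: (@cstarM_neg_sqr (a ** k)); first by rewrite cstarM hk hr.
  rewrite cstarM hk cmulA -(cmulA k) -/h -cmulA hkE cmulNr; congr (- _).
  by rewrite -rr {2}kr !cmulA.
have mk : m ** k = 0 by rewrite -rr -cmulA -kr cmulA -kr w0 cmul0l.
have k0 : k = 0.
  by apply: herm_sqr_eq0 => //; rewrite {1}/k cmulBl hkE mk oppr0 subr0.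
by have -> : h = m by apply/esym/eqP; rewrite -subr_eq0 -/k k0.
Qed.

End Positivity.

(** * The Hahn-Banach theorem *)

Section HahnBanach.
Variables (R : realType) (V : lmodType R[i]).
Implicit Types (p q : V -> R) (x y : V) (r s : R).

(** Sublinearity over the reals, on a complex space: the functionals wanted
    are real parts of complex ones. *)
Definition sublinear p :=
  (forall x y, p (x + y) <= p x + p y) /\
  (forall r x, 0 <= r -> p (r%:C *: x) <= r * p x).

Lemma sublinear0 p : sublinear p -> p 0 = 0.
Proof.
move=> [pD pZ]; apply/eqP; rewrite eq_le; apply/andP; split.
  by have := pZ 0 0 (lexx _); rewrite scaler0 mul0r.
by have := pD 0 0; rewrite addr0 lerDl.
Qed.

Lemma sublinearZ p r x : sublinear p -> 0 <= r -> p (r%:C *: x) = r * p x.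
Proof.
move=> ps r0; have [pD pZ] := ps.
have [->|rN0] := eqVneq r 0; first by rewrite scale0r mul0r sublinear0.
have rp : 0 < r by rewrite lt_neqAle eq_sym rN0.
apply/eqP; rewrite eq_le pZ//=.
have := pZ r^-1 (r%:C *: x); rewrite scalerA -C_M mulVf// scale1r.
by rewrite invr_ge0 => /(_ r0); rewrite ler_pdivlMl.
Qed.

Lemma sublinear_opp p x : sublinear p -> - p (- x) <= p x.
Proof.
move=> ps; have [pD _] := ps.
by have := pD x (- x); rewrite subrr (sublinear0 ps); lra.
Qed.

Lemma le_inf_add (E F : set R) c : E !=set0 -> F !=set0 ->
  (forall a b, E a -> F b -> c <= a + b) -> c <= inf E + inf F.
Proof.
move=> E0 F0 h; rewrite -lerBlDr; apply: lb_le_inf => // a Ea.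
rewrite lerBlDr -lerBlDl; apply: lb_le_inf => // b Fb.
by rewrite lerBlDl h.
Qed.

(** [tilt q y] is the largest sublinear functional below [q] with the value
    [- q y] at [- y]. *)
Definition tilt_set q y x := [set q (x + s%:C *: y) - s * q y | s in [set s | 0 <= s]].
Definition tilt q y x : R := inf (tilt_set q y x).

Section Tilt.
Variables (q : V -> R) (y : V) (qs : sublinear q).

Lemma tilt_nonempty x : tilt_set q y x !=set0.
Proof. by exists (q (x + (0 : R)%:C *: y) - 0 * q y); exists 0 => /=. Qed.

Lemma tilt_lbound x : has_lbound (tilt_set q y x).
Proof.
exists (- q (- x)) => _ [s /= s0 <-].
have := qs.1 (x + s%:C *: y) (- x).
by rewrite addrAC subrr add0r sublinearZ//; lra.
Qed.

Lemma tilt_le s x : 0 <= s -> tilt q y x <= q (x + s%:C *: y) - s * q y.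
Proof. by move=> s0; apply: (ge_inf (tilt_lbound x)); exists s. Qed.

Lemma tilt_le_self x : tilt q y x <= q x.
Proof. by have := tilt_le x (lexx 0); rewrite scale0r addr0 mul0r subr0. Qed.

Lemma tilt_opp : tilt q y (- y) <= - q y.
Proof.
by have := tilt_le (- y) ler01; rewrite scale1r addNr sublinear0// sub0r mul1r.
Qed.

Lemma tilt_sublinear : sublinear (tilt q y).
Proof.
split=> [x z|r x r0].
  apply: le_inf_add; [exact: tilt_nonempty|exact: tilt_nonempty|].
  move=> _ _ [s /= s0 <-] [t /= t0 <-].
  apply: (le_trans (tilt_le _ (addr_ge0 s0 t0))).
  rewrite C_D scalerDl addrACA.
  by have := qs.1 (x + s%:C *: y) (z + t%:C *: y); lra.
have [->|rN0] := eqVneq r 0.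
  by rewrite scale0r mul0r (le_trans (tilt_le_self 0))// sublinear0.
have rp : 0 < r by rewrite lt_neqAle eq_sym rN0.
rewrite mulrC -ler_pdivrMr//; apply: lb_le_inf; first exact: tilt_nonempty.
move=> _ [s /= s0 <-]; rewrite ler_pdivrMr//.
apply: (le_trans (tilt_le _ (mulr_ge0 r0 s0))).
rewrite C_M -scalerA -scalerDr sublinearZ//; lra.
Qed.

End Tilt.

Section Minimal.
Variables (p : V -> R) (ps : sublinear p).

Let S := {q : V -> R | sublinear q /\ forall x, q x <= p x}.
Let below (q1 q2 : S) : bool := `[< forall x, sval q2 x <= sval q1 x >].

(** The pointwise infimum is finite because a sublinear [q <= p] satisfies
    [q x >= - p (- x)], and it is subadditive because one of any two members of
    the chain lies below the other. *)
Let chain_lower_bound (C : set S) : total_on C (fun q1 q2 : S => below q1 q2) ->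
  exists q : S, forall q1 : S, C q1 -> below q1 q.
Proof.
move=> tot; have [[q0 Cq0]|C0] := pselect (C !=set0); last first.
  exists (exist _ p (conj ps (fun x => lexx (p x)))) => q1 Cq1.
  by exfalso; apply: C0; exists q1.
pose E x := [set sval (q : S) x | q in C].
have E0 x : E x !=set0 by exists (sval q0 x); exists q0.
have lbE x : has_lbound (E x).
  exists (- p (- x)) => _ [q _ <-]; have [qs qp] := svalP q.
  by apply: le_trans (sublinear_opp _ qs); rewrite lerN2.
have le (q : S) x : C q -> inf (E x) <= sval q x.
  by move=> Cq; apply: (ge_inf (lbE x)); exists q.
have gs : sublinear (fun x => inf (E x)).
  split=> [x z|r x r0].
    apply: le_inf_add => // _ _ [q1 C1 <-] [q2 C2 <-].
    have [/asboolP b|/asboolP b] := tot _ _ C1 C2.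
      apply: (le_trans (le q2 _ C2)).
      by rewrite (le_trans ((svalP q2).1.1 _ _))// lerD2r.
    apply: (le_trans (le q1 _ C1)).
    by rewrite (le_trans ((svalP q1).1.1 _ _))// lerD2l.
  have [->|rN0] := eqVneq r 0.
    rewrite scale0r mul0r (le_trans (le q0 _ Cq0))//.
    by rewrite (sublinear0 (svalP q0).1).
  have rp : 0 < r by rewrite lt_neqAle eq_sym rN0.
  rewrite mulrC -ler_pdivrMr//; apply: lb_le_inf => // _ [q Cq <-].
  rewrite ler_pdivrMr// mulrC (le_trans (le q _ Cq))//.
  exact: (svalP q).1.2.
have gp x : inf (E x) <= p x.
  exact: le_trans (le q0 x Cq0) ((svalP q0).2 x).
exists (exist _ (fun x => inf (E x)) (conj gs gp) : S) => q Cq.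
by apply/asboolP => x; exact: le.
Qed.

(** A minimal sublinear functional is linear: tilting it in any direction
    does not change it. *)
Lemma real_linear_below : exists f : V -> R,
  [/\ forall x y, f (x + y) = f x + f y,
      forall r x, f (r%:C *: x) = r * f x
    & forall x, f x <= p x].
Proof.
have [|||q qmin] := @Zorn S below _ _ _ chain_lower_bound; rewrite /below.
- by move=> [q h]; apply/asboolP.
- move=> [q1 ?] [q2 ?] [q3 ?] /asboolP h1 /asboolP h2; apply/asboolP => x.
  exact: le_trans (h2 x) (h1 x).
- move=> [q1 h1] [q2 h2] /asboolP/= l1 /asboolP/= l2.
  have e : q1 = q2 by apply/funext => x; apply/eqP; rewrite eq_le l1 l2.
  by case: _ / e h2 {l1 l2} => h2; congr (exist _ _ _); exact: Prop_irrelevance.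
have [qs qp] := svalP q; set f := sval q in qs qp.
have fN y : f (- y) = - f y.
  apply/eqP; rewrite eq_le; apply/andP; split; last first.
    by rewrite lerNl sublinear_opp.
  have tp x : tilt f y x <= p x := le_trans (tilt_le_self y qs x) (qp x).
  have /(congr1 sval)/= e := qmin (exist _ (tilt f y) (conj (tilt_sublinear y qs) tp) : S)
    (introT (asboolP _) (tilt_le_self y qs)).
  by rewrite {1}/f -e tilt_opp.
exists f; split=> // [x y|r x].
  apply/eqP; rewrite eq_le qs.1 /=.
  have := qs.1 (x + y) (- y); rewrite addrK fN; lra.
have [r0|r0] := leP 0 r; first exact: sublinearZ.
rewrite -[r]opprK C_N scaleNr fN sublinearZ ?mulNr//.
by rewrite oppr_ge0 ltW.
Qed.

End Minimal.

(** Tilting [p] along [x0] first forces [f (- x0) <= - p x0]. *)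
Theorem hahn_banach p x0 : sublinear p -> exists f : V -> R,
  [/\ forall x y, f (x + y) = f x + f y,
      forall r x, f (r%:C *: x) = r * f x,
      forall x, f x <= p x
    & f x0 = p x0].
Proof.
move=> ps; have [f [fD fZ fp]] := real_linear_below (tilt_sublinear x0 ps).
have fN : f (- x0) = - f x0.
  by have := fZ (-1) x0; rewrite C_N scaleN1r mulN1r.
have le x : f x <= p x := le_trans (fp x) (tilt_le_self x0 ps x).
exists f; split=> //; apply/eqP; rewrite eq_le le/=.
by have := le_trans (fp (- x0)) (tilt_opp x0 ps); rewrite fN lerN2.
Qed.

End HahnBanach.

(** * Positive functionals *)

Record positive_functional (R : realType) (A : cstarAlgType R) (F : A -> R[i])
    : Prop := {
  pfD : forall x y, F (x + y) = F x + F y ;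
  pfZ : forall (k : R[i]) x, F (k *: x) = k * F x ;
  pf_star : forall x, F (cstar x) = ((F x)^*)%R ;
  pf_ge0 : forall x, 0 <= F (cstar x ** x)
}.

Section ExistenceOfFunctionals.
Variables (R : realType) (A : unitalCStarAlgType R).
Implicit Types (x y z a b h u v w : A) (r t : R).
Notation one := (@cone R A).

Definition upper_bounds x : set R :=
  [set t | psd (t%:C *: one - (x + cstar x))].

(** The largest spectral value of [x + x*].  It sees [x] only through its
    hermitian part, so a linear functional below it vanishes on skew elements. *)
Definition upper_gauge x : R := inf (upper_bounds x).

Hypothesis nontrivial : one != 0.

Lemma psd_real_ge0 t : psd (t%:C *: one) -> 0 <= t.
Proof.
move=> p; rewrite leNgt; apply/negP => t0.
have : t%:C *: one = 0.
  apply: psd_eq0 => //; rewrite -scaleNr -C_N; apply: psd_real.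
  by rewrite oppr_ge0 ltW.
move=> /eqP; rewrite scaler_eq0 (negPf nontrivial) orbF => /eqP e.
by move: t0; rewrite (C_inj e : t = 0) ltxx.
Qed.

Lemma herm_addstar x : cstar (x + cstar x) = x + cstar x.
Proof. by rewrite cstarD cstarK addrC. Qed.

Lemma upper_bounds_nonempty x : upper_bounds x !=set0.
Proof.
by exists (nrm (x + cstar x)); apply: psd_sub_real => //; exact: herm_addstar.
Qed.

Lemma upper_bounds_lbound x : has_lbound (upper_bounds x).
Proof.
exists (- nrm (x + cstar x)) => t /= pt.
rewrite -subr_ge0 opprK; apply: psd_real_ge0.
rewrite C_D scalerDl -[X in X + _](subrK (x + cstar x)) -addrA.
by apply: psdD => //; rewrite addrC; apply: psd_add_real => //; exact: herm_addstar.
Qed.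

Lemma upper_gauge_le x t : upper_bounds x t -> upper_gauge x <= t.
Proof. by move=> h; apply: (ge_inf (upper_bounds_lbound x)). Qed.

Lemma upper_gauge_sublinear : sublinear upper_gauge.
Proof.
split=> [x y|r x r0].
  apply: le_inf_add; [exact: upper_bounds_nonempty|exact: upper_bounds_nonempty|].
  move=> s t /= hs ht; apply: upper_gauge_le; rewrite /upper_bounds/=.
  by rewrite C_D scalerDl cstarD addrACA opprD addrACA; exact: psdD.
have [->|rN0] := eqVneq r 0.
  rewrite scale0r mul0r; apply: upper_gauge_le; rewrite /upper_bounds/=.
  by rewrite scale0r cstar0 addr0 subr0 -(scale0r one); exact: psd_real.
have rp : 0 < r by rewrite lt_neqAle eq_sym rN0.
rewrite mulrC -ler_pdivrMr//; apply: lb_le_inf => [|t /= ht].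
  exact: upper_bounds_nonempty.
rewrite ler_pdivrMr//; apply: upper_gauge_le; rewrite /upper_bounds/=.
by rewrite cstarZr -scalerDr mulrC C_M -scalerA -scalerBr; exact: psdZ.
Qed.

Lemma upper_gauge_le0 x : psd (- (x + cstar x)) -> upper_gauge x <= 0.
Proof. by move=> px; apply: upper_gauge_le; rewrite /upper_bounds/= scale0r add0r. Qed.

Lemma upper_gauge_psd_eq0 h : psd h -> upper_gauge h <= 0 -> h = 0.
Proof.
move=> ph h0; have [hh _] := ph.
suff : h + h = 0.
  by move=> /eqP; rewrite -mulr2n -scaler_nat scaler_eq0 pnatr_eq0 => /eqP.
apply: nrm_small => e e0; apply: psd_bound; first exact: ltW.
  have [|t /= ht te] := @inf_lt _ (upper_bounds h) e (upper_bounds_nonempty h).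
    exact: le_lt_trans e0.
  rewrite -(subrK t e) C_D scalerDl -addrA -{2}hh; apply: psdD => //.
  by apply: psd_real; rewrite subr_ge0 ltW.
by apply: psdD; [apply: psd_real; exact: ltW | exact: psdD].
Qed.

Lemma scale_complex (V : lmodType R[i]) (k : R[i]) (x : V) :
  k *: x = (complex.Re k)%:C *: x + (complex.Im k)%:C *: ('i *: x).
Proof. by rewrite scalerA -scalerDl {1}(complexE k) mulrC complexiE. Qed.

(** A real functional [f] below [upper_gauge] is nonnegative on positive
    elements and vanishes on skew ones; [F x = f x - i f (i x)] is the complex
    functional with real part [f].  It is not zero at [h] because [f h] is the
    gauge of [h]. *)
Lemma positive_functional_psd h : psd h -> h != 0 ->
  exists F : A -> R[i], positive_functional F /\ F h != 0.
Proof.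
move=> ph hN0.
have [f [fD fZ fp fh]] := hahn_banach h upper_gauge_sublinear.
have fN x : f (- x) = - f x by have := fZ (-1) x; rewrite C_N scaleN1r mulN1r.
have skew x : cstar x = - x -> f x = 0.
  have le0 y : cstar y = - y -> f y <= 0.
    move=> hy; apply: le_trans (fp y) _; apply: upper_gauge_le0.
    by rewrite hy subrr oppr0 -(scale0r one); exact: psd_real.
  move=> hx; apply/eqP; rewrite eq_le le0//= -oppr_le0 -fN le0//.
  by rewrite cstarN hx.
have fstar x : f (cstar x) = f x.
  apply/eqP; rewrite -subr_eq0 -fN -fD; apply/eqP; apply: skew.
  by rewrite cstarB cstarK opprB.
have ii x : 'i *: ('i *: x) = - x by rewrite scalerA -expr2 sqrCi scaleN1r.
pose F x : R[i] := f x +i* - f ('i *: x).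
exists F; split; first split.
- by move=> x y; rewrite /F scalerDr !fD opprD.
- move=> k x; rewrite /F.
  have -> : f ('i *: (k *: x)) = complex.Re k * f ('i *: x) - complex.Im k * f x.
    by rewrite (scale_complex k) scalerDr !scalerA ![_ * _%:C]mulrC -!scalerA ii
      fD !fZ fN mulrN.
  rewrite (scale_complex k) fD !fZ.
  case: k => a b /=; apply/eqP; rewrite eq_complex /=; apply/andP; split;
    apply/eqP; ring.
- move=> x; rewrite /F fstar.
  have -> : f ('i *: cstar x) = - f ('i *: x).
    by rewrite -(opprK ('i *: cstar x)) -cstar_i fN fstar.
  by rewrite opprK; apply/eqP; rewrite eq_complex/= opprK !eqxx.
- move=> x; rewrite /F (skew ('i *: _)) ?oppr0; last by rewrite cstar_i cstarM cstarK.
  rewrite -[_ +i* 0]/((_)%:C) C0_le -oppr_le0 -fN.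
  apply: le_trans (fp _) _; apply: upper_gauge_le0.
  rewrite cstarN cstarM cstarK -opprD opprK.
  by apply: psdD; exact: psd_cstarM.
apply: contra_neq hN0 => Fh; apply: upper_gauge_psd_eq0 => //.
by rewrite -fh; have /(congr1 (@complex.Re R))/= -> := Fh.
Qed.

End ExistenceOfFunctionals.

Section Functionals.
Variables (R : realType) (A : unitalCStarAlgType R).
Implicit Types (x y z a b c h u v w : A) (r t : R).

(** The element [a] acts nontrivially in some Gelfand-Naimark-Segal
    representation: take [F] nonzero at [q^2] with [q = a a*]; then [a] does
    not kill the vector [y = a*]. *)
Lemma positive_functional_separates a : a != 0 ->
  exists (F : A -> R[i]) y,
    positive_functional F /\ F (cstar (a ** y) ** (a ** y)) != 0.
Proof.
move=> aN0; pose q := a ** cstar a.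
have hq : cstar q = q by rewrite cstarM cstarK.
have qq0 : q ** q != 0.
  apply: contra_neq aN0 => /(herm_sqr_eq0 hq) q0.
  rewrite -(cstarK a); suff -> : cstar a = 0 by rewrite cstar0.
  apply/nrm_eq0/eqP; rewrite -sqrf_eq0 -nrm_cstarM cstarK.
  by rewrite -/q q0 nrm0.
have one0 : cone != 0 :> A.
  by apply: contra_neq aN0 => e; rewrite -(cmul1l a) e cmul0l.
have [F [PF Fh]] := positive_functional_psd one0 (psd_sqr hq) qq0.
by exists F, (cstar a); split=> //; rewrite -/q hq.
Qed.

Variables (F : A -> R[i]) (PF : positive_functional F).

(** Left multiplication is bounded for the semi-inner product: with
    [s^2 = ||c||^2 - c* c] the difference of the two sides is
    [F ((s v)* (s v))]. *)
Lemma pf_contract c v :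
  F (cstar (c ** v) ** (c ** v)) <= (nrm c ^+ 2)%:C * F (cstar v ** v).
Proof.
have hc : cstar (cstar c ** c) = cstar c ** c by rewrite cstarM cstarK.
have [|s [[hs _] ss _]] := psd_sqrt (psd_sub_real hc (t := nrm c ^+ 2) _).
  by rewrite nrm_cstarM.
have := pf_ge0 PF (s ** v).
rewrite cstarM hs cmulA -(cmulA (cstar v)) ss cmulBr cmulBl cmul_realr cmulZl.
rewrite (pfD PF) (pfZ PF) -scaleN1r (pfZ PF) mulN1r subr_ge0.
by rewrite cstarM !cmulA.
Qed.

End Functionals.

(** * The unitization *)

(** Operator norms are specified by their upper bounds: [bnd r x] says that the
    norm of [x] is at most [r], and the norm is recovered as an infimum. *)
Record norm_bounds (R : realType) (V : lmodType R[i]) (bnd : R -> V -> Prop)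
    : Prop := {
  bnd_ge0 : forall r x, bnd r x -> 0 <= r ;
  bnd_closed : forall r x, (forall e : R, 0 < e -> bnd (r + e) x) -> bnd r x ;
  bnd_le : forall r s x, bnd r x -> r <= s -> bnd s x ;
  bnd_ex : forall x, exists r, bnd r x ;
  bnd_eq0 : forall x, bnd 0 x -> x = 0 ;
  bndD : forall r s x y, bnd r x -> bnd s y -> bnd (r + s) (x + y) ;
  bndZ : forall r k x, bnd r x -> bnd (cabs k * r) (k *: x)
}.

Section NormOfBounds.
Variables (R : realType) (V : lmodType R[i]) (bnd : R -> V -> Prop).

Definition norm_of_bounds (x : V) : R := inf [set r | bnd r x].

Hypothesis nb : norm_bounds bnd.

Lemma norm_of_boundsP x r : norm_of_bounds x <= r <-> bnd r x.
Proof.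
have lb : has_lbound [set r | bnd r x] by exists 0 => s /= /(bnd_ge0 nb).
split=> [h|h]; last exact: (ge_inf lb).
apply: (bnd_closed nb) => e e0.
have [|s /= hs sr] := @inf_lt _ [set r | bnd r x] (r + e) (bnd_ex nb x).
  by rewrite (le_lt_trans h)// ltrDl.
exact: (bnd_le nb hs (ltW sr)).
Qed.

Lemma norm_of_bounds_bnd x : bnd (norm_of_bounds x) x.
Proof. by apply/norm_of_boundsP. Qed.

Lemma norm_of_bounds_ge0 x : 0 <= norm_of_bounds x.
Proof. exact: (bnd_ge0 nb (norm_of_bounds_bnd x)). Qed.

Lemma norm_of_boundsD x y :
  (norm_of_bounds (x + y))%:C <= (norm_of_bounds x)%:C + (norm_of_bounds y)%:C.
Proof.
rewrite -C_D C_le; apply/norm_of_boundsP.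
by apply: (bndD nb); exact: norm_of_bounds_bnd.
Qed.

Lemma norm_of_boundsZ k x :
  (norm_of_bounds (k *: x))%:C = `|k| * (norm_of_bounds x)%:C.
Proof.
have le k' y : norm_of_bounds (k' *: y) <= cabs k' * norm_of_bounds y.
  by apply/norm_of_boundsP/(bndZ nb)/norm_of_bounds_bnd.
rewrite cabsE -C_M; congr (_ %:C); apply/eqP; rewrite eq_le le/=.
have [->|kN0] := eqVneq k 0; first by rewrite cabs0 mul0r norm_of_bounds_ge0.
have := le k^-1 (k *: x); rewrite scalerA mulVf// scale1r.
have kp : 0 < cabs k.
  by rewrite lt_neqAle cabs_ge0 andbT eq_sym; apply: contra_neq kN0 => /cabs_eq0.
move=> h; rewrite -ler_pdivlMl// (le_trans h)// ler_wpM2r ?norm_of_bounds_ge0//.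
by rewrite -(ler_pM2l kp) -cabsM mulfV// cabs1 mulfV// gt_eqF.
Qed.

Lemma norm_of_bounds_eq0 x : (norm_of_bounds x)%:C = 0 -> x = 0.
Proof.
move=> /C_inj e; apply: (bnd_eq0 nb).
by rewrite -e; exact: norm_of_bounds_bnd.
Qed.

End NormOfBounds.

Lemma le_sqrt_mul (R : realType) (r s t : R) : 0 <= s -> 0 <= t ->
  r ^+ 2 <= s * t ^+ 2 -> r <= Num.sqrt s * t.
Proof.
move=> s0 t0 h; have [r0|r0] := leP r 0.
  by rewrite (le_trans r0) ?mulr_ge0 ?sqrtr_ge0.
by rewrite -ler_sqr ?nnegrE ?(ltW r0) ?mulr_ge0 ?sqrtr_ge0// exprMn sqr_sqrtr.
Qed.

(** From [N x ^ 2 <= N (x* x) <= N x* N x] the involution is isometric, which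
    gives the opposite inequality. *)
Lemma cstar_identity (R : realType) (T : Type) (N : T -> R)
    (mul : T -> T -> T) (star : T -> T) (x : T) :
  (forall x, 0 <= N x) -> involutive star ->
  (forall x y, N (mul x y) <= N x * N y) ->
  (forall x, N x ^+ 2 <= N (mul (star x) x)) ->
  N (mul (star x) x) = N x ^+ 2.
Proof.
move=> N0 sK NM NC.
have le y : N y <= N (star y).
  have [->//|y0] := eqVneq (N y) 0.
  have yp : 0 < N y by rewrite lt_neqAle eq_sym y0 N0.
  by rewrite -(ler_pM2r yp) -expr2 (le_trans (NC y)).
apply/eqP; rewrite eq_le NC andbT (le_trans (NM _ _))// expr2 ler_wpM2r//.
by rewrite -{2}(sK x) le.
Qed.

Definition unitization (R : realType) (A : cstarAlgType R) : Type :=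
  (A * R[i]^o)%type.

HB.instance Definition _ (R : realType) (A : cstarAlgType R) :=
  GRing.Lmodule.copy (unitization A) (A * R[i]^o)%type.

Section Unitization.
Variables (R : realType) (A : cstarAlgType R).
Implicit Types (x y z : unitization A) (a b : A) (r s : R).

Definition unit_act x b : A := x.1 ** b + x.2 *: b.

(** The operator norm of left multiplication alone is only a seminorm when [A]
    has a unit; the scalar part is added to separate points. *)
Definition unit_bnd r x :=
  [/\ 0 <= r, cabs x.2 <= r & forall b, nrm (unit_act x b) <= r * nrm b].

Definition unit_mul x y : unitization A :=
  (x.1 ** y.1 + (x.2 *: y.1 + y.2 *: x.1), x.2 * y.2).
Definition unit_star x : unitization A := (cstar x.1, (x.2^*)%R).
Definition unit_one : unitization A := (0, 1).

Lemma unit_actM x y b : unit_act (unit_mul x y) b = unit_act x (unit_act y b).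
Proof.
rewrite /unit_act /= !cmulDl !cmulDr !cmulZl !cmulZr scalerDr scalerA cmulA.
by rewrite -!addrA; congr (_ + _); rewrite addrCA.
Qed.

Lemma unit_actD x y b : unit_act (x + y) b = unit_act x b + unit_act y b.
Proof. by rewrite /unit_act cmulDl scalerDl addrACA. Qed.

Lemma unit_actZ k x b : unit_act (k *: x) b = k *: unit_act x b.
Proof. by rewrite /unit_act cmulZl scalerDr scalerA. Qed.

(** The C*-identity of [A] at [x b] is what gives the one of the unitization. *)
Lemma unit_act_star x b :
  cstar (unit_act x b) ** unit_act x b = cstar b ** unit_act (unit_mul (unit_star x) x) b.
Proof.
rewrite unit_actM; set y := unit_act x b.
rewrite -[unit_act (unit_star x) y]/(cstar x.1 ** y + (x.2^*)%R *: y).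
have ys : cstar y = cstar b ** cstar x.1 + (x.2^*)%R *: cstar b.
  by rewrite /y cstarD cstarM cstarZ.
by clearbody y; rewrite ys cmulDl cmulZl cmulDr cmulZr cmulA.
Qed.

(** The norm of the unitization controls the component in [A], so Cauchy
    sequences are Cauchy in both components. *)
Lemma unit_bnd_fst r x : unit_bnd r x -> nrm x.1 <= 2 * r.
Proof.
move=> [r0 h2 h]; pose b := cstar x.1.
have [->|N0] := eqVneq (nrm x.1) 0; first by rewrite mulr_ge0.
have xp : 0 < nrm x.1 by rewrite lt_neqAle eq_sym N0 nrm_ge0.
rewrite -(ler_pM2r xp) -expr2 -nrm_cstar -nrm_cstarM cstarK -/b.
have -> : x.1 ** b = unit_act x b - x.2 *: b by rewrite /unit_act addrK.
rewrite (le_trans (nrmD _ _))// nrmN nrmZ.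
have := h b; have := nrm_ge0 b => b0.
have : cabs x.2 * nrm b <= r * nrm b by rewrite ler_wpM2r.
rewrite -mulrA; lra.
Qed.

Lemma unit_bnd_of r s a (l : R[i]) : nrm a <= r -> cabs l <= s ->
  unit_bnd (r + s) (a, l).
Proof.
move=> ar ls; have r0 := le_trans (nrm_ge0 _) ar.
have s0 := le_trans (cabs_ge0 _) ls.
split=> /=; first exact: addr_ge0.
  by rewrite (le_trans ls)// lerDr.
move=> b; rewrite /unit_act/= (le_trans (nrmD _ _))// mulrDl lerD//.
  by rewrite (le_trans (nrmM _ _))// ler_wpM2r ?nrm_ge0.
by rewrite nrmZ ler_wpM2r ?nrm_ge0.
Qed.

Lemma unit_norm_bounds : norm_bounds unit_bnd.
Proof.
split.
- by move=> r x [].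
- move=> r x h; split.
  + by apply/ler_addgt0Pr => e /h[].
  + by apply/ler_addgt0Pr => e /h[].
  + move=> b; apply/ler_addgt0Pr => e e0.
    pose d := e / (nrm b + 1).
    have bp : 0 < nrm b + 1 by rewrite ltr_wpDl// nrm_ge0.
    have [|_ _ /(_ b)/le_trans] := h d; first by rewrite divr_gt0.
    apply; rewrite mulrDl lerD2l /d mulrAC ler_pdivrMr// ler_pM2l//.
    by rewrite lerDl ler01.
- move=> r s x [r0 h1 h2] rs; split; [exact: le_trans rs|exact: le_trans rs|].
  by move=> b; rewrite (le_trans (h2 b))// ler_wpM2r// nrm_ge0.
- move=> [a l]; exists (nrm a + cabs l); exact: unit_bnd_of.
- move=> [a l] h; have := unit_bnd_fst h; have [_ h2 _] := h.
  rewrite mulr0 /= => ha; congr (_, _).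
    by apply/nrm_eq0/eqP; rewrite eq_le nrm_ge0 andbT.
  by apply/cabs_eq0/eqP; rewrite eq_le cabs_ge0 andbT.
- move=> r s x y [r0 h1 h2] [s0 k1 k2]; split; first exact: addr_ge0.
    by rewrite (le_trans (cabsD _ _))// lerD.
  by move=> b; rewrite unit_actD (le_trans (nrmD _ _))// mulrDl lerD.
- move=> r k x [r0 h1 h2]; split; first by rewrite mulr_ge0// cabs_ge0.
    by rewrite cabsM ler_wpM2l// cabs_ge0.
  by move=> b; rewrite unit_actZ nrmZ -mulrA ler_wpM2l// cabs_ge0.
Qed.

HB.instance Definition _ := @Lmodule_isNormed.Build R[i] (unitization A)
  (fun x => (norm_of_bounds unit_bnd x)%:C)
  (norm_of_boundsD unit_norm_bounds) (norm_of_boundsZ unit_norm_bounds)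
  (norm_of_bounds_eq0 unit_norm_bounds).

Lemma unit_nrmP x r : nrm x <= r <-> unit_bnd r x.
Proof. exact: (norm_of_boundsP unit_norm_bounds). Qed.

Lemma unit_complete (F : set_system (unitization A)) :
  ProperFilter F -> cauchy F -> cvg F.
Proof.
apply: complete_of_cauchy_seq => u cu.
have [|a /nrm_cvgP Ha] := @cauchy_seq_cvg R A (fun n => (u n).1).
  move=> e e0; have [|N HN] := cu (e / 2); first by rewrite divr_gt0.
  exists N => m n hm hn; have /unit_nrmP/unit_bnd_fst := HN _ _ hm hn.
  by rewrite mulrC divfK.
have [|l Hl] := @complex_cauchy_seq_cvg R (fun n => (u n).2).
  by move=> e /cu[N HN]; exists N => m n hm hn; have /unit_nrmP[] := HN _ _ hm hn.
exists (a, l); apply/nrm_cvgP => e e0.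
have [|N HN] := Ha (e / 2); first by rewrite divr_gt0.
have [|M HM] := Hl (e / 2); first by rewrite divr_gt0.
exists (maxn N M) => n; rewrite geq_max => /andP[/HN h1 /HM h2].
by apply/unit_nrmP; rewrite (splitr e); exact: unit_bnd_of.
Qed.

HB.instance Definition _ := Uniform_isComplete.Build (unitization A) unit_complete.

Lemma unit_mulA : associative unit_mul.
Proof.
move=> x y z; congr (_, _) => /=; last by rewrite mulrA.
rewrite !cmulDr !cmulDl !cmulZr !cmulZl !scalerDr !scalerA !cmulA (mulrC z.2 x.2).
rewrite (mulrC z.2 y.2) -!addrA; congr (_ + _).
rewrite [RHS]addrCA; congr (_ + _); rewrite [LHS]addrCA; congr (_ + _).
by rewrite [LHS]addrCA.
Qed.

Lemma unit_mulDl : left_distributive unit_mul +%R.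
Proof.
move=> x y z; congr (_, _) => /=; last by rewrite mulrDl.
rewrite cmulDl scalerDl scalerDr [RHS]addrACA; congr (_ + _).
by rewrite [RHS]addrACA.
Qed.

Lemma unit_mulDr : right_distributive unit_mul +%R.
Proof.
move=> x y z; congr (_, _) => /=; last by rewrite mulrDr.
rewrite cmulDr scalerDl scalerDr [RHS]addrACA; congr (_ + _).
by rewrite [RHS]addrACA.
Qed.

Lemma unit_mulZl (k : R[i]) x y : unit_mul (k *: x) y = k *: unit_mul x y.
Proof.
congr (_, _) => /=; last by rewrite -mulrA.
by rewrite cmulZl !scalerDr !scalerA (mulrC y.2).
Qed.

Lemma unit_mulZr (k : R[i]) x y : unit_mul x (k *: y) = k *: unit_mul x y.
Proof.
congr (_, _) => /=; last by rewrite mulrCA.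
by rewrite cmulZr !scalerDr !scalerA (mulrC x.2).
Qed.

Lemma unit_starD : {morph unit_star : x y / x + y}.
Proof. by move=> x y; congr (_, _) => /=; rewrite ?cstarD// rmorphD. Qed.

Lemma unit_starZ (k : R[i]) x : unit_star (k *: x) = (k^*)%R *: unit_star x.
Proof. by congr (_, _) => /=; rewrite ?cstarZ// rmorphM. Qed.

Lemma unit_starM x y : unit_star (unit_mul x y) = unit_mul (unit_star y) (unit_star x).
Proof.
congr (_, _) => /=; last by rewrite rmorphM mulrC.
by rewrite !cstarD !cstarZ cstarM; congr (_ + _); rewrite addrC.
Qed.

Lemma unit_starK : involutive unit_star.
Proof. by move=> [a l]; congr (_, _) => /=; rewrite ?cstarK ?conjCK. Qed.

Lemma unit_normM x y : nrm (unit_mul x y) <= nrm x * nrm y.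
Proof.
have /unit_nrmP[r0 h1 h2] := lexx (nrm x); have /unit_nrmP[s0 k1 k2] := lexx (nrm y).
apply/unit_nrmP; split; first exact: mulr_ge0.
  by rewrite /= cabsM ler_pM// cabs_ge0.
by move=> b; rewrite unit_actM (le_trans (h2 _))// -mulrA ler_wpM2l.
Qed.

Lemma unit_norm_star_le x : nrm x ^+ 2 <= nrm (unit_mul (unit_star x) x).
Proof.
set s := nrm (unit_mul _ _); have s0 : 0 <= s := nrm_ge0 _.
have /unit_nrmP[_ h1 h2] := lexx s.
rewrite -[leRHS](sqr_sqrtr s0) ler_sqr ?nnegrE ?sqrtr_ge0 ?nrm_ge0//.
apply/unit_nrmP; split; first exact: sqrtr_ge0.
  rewrite -[leRHS]mulr1; apply: le_sqrt_mul => //.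
  by rewrite expr1n mulr1 (le_trans _ h1)//= cabsM cabs_conj.
move=> b; apply: le_sqrt_mul => //; first exact: nrm_ge0.
rewrite -nrm_cstarM unit_act_star (le_trans (nrmM _ _))// nrm_cstar.
by rewrite (le_trans (ler_wpM2l (nrm_ge0 b) (h2 b)))// expr2 mulrCA.
Qed.

Lemma unit_cnormM_le x y : `|unit_mul x y| <= `|x| * `|y|.
Proof. by rewrite !nrmE -C_M C_le unit_normM. Qed.

Lemma unit_cnorm_cstar x : `|unit_mul (unit_star x) x| = `|x| ^+ 2.
Proof.
rewrite !nrmE (cstar_identity _ (@nrm_ge0 _ _) unit_starK unit_normM unit_norm_star_le).
by rewrite !expr2 C_M.
Qed.

HB.instance Definition _ := isCStarAlgebra.Build R (unitization A)
  unit_mulA unit_mulDl unit_mulDr unit_mulZl unit_mulZr unit_starD unit_starZ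
  unit_starM unit_starK unit_cnormM_le unit_cnorm_cstar.

Lemma unit_mul1l : left_id unit_one unit_mul.
Proof.
move=> [a l]; congr (_, _) => /=; last by rewrite mul1r.
by rewrite cmul0l scale1r scaler0 addr0 add0r.
Qed.

Lemma unit_mul1r : right_id unit_one unit_mul.
Proof.
move=> [a l]; congr (_, _) => /=; last by rewrite mulr1.
by rewrite cmul0r scale1r scaler0 !add0r.
Qed.

HB.instance Definition _ :=
  CStarAlgebra_isUnital.Build R (unitization A) unit_mul1l unit_mul1r.

Definition unit_inj a : unitization A := (a, 0).

Lemma unit_inj_star_hom : star_hom (unit_inj : A -> unitization A).
Proof.
split.
- by move=> k a b; congr (_, _); rewrite /= scaler0 addr0.
- by move=> a b; congr (_, _) => /=; rewrite ?mul0r// !scale0r !addr0.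
- by move=> a; congr (_, _); rewrite /= conjC0.
Qed.

Lemma unit_inj_eq0 a : unit_inj a = 0 -> a = 0.
Proof. by case. Qed.

End Unitization.

(** * Finite-dimensional compressions *)

HB.lock Definition rdot (R : realType) (n : nat) (u v : 'rV[R[i]]_n) : R[i] :=
  dotmx u v.

HB.lock Definition rnorm (R : realType) (n : nat) (u : 'rV[R[i]]_n) : R :=
  Num.sqrt (complex.Re (rdot u u)).

Section RowVectors.
Variables (R : realType) (n : nat).
Implicit Types (u v w : 'rV[R[i]]_n) (k : R[i]).

Lemma rdot_sum u v : rdot u v = \sum_j u 0 j * ((v 0 j)^*)%R.
Proof.
by rewrite rdot.unlock dotmxE mxE; apply: eq_bigr => j _; rewrite !mxE.
Qed.

Lemma rdotBl u v w : rdot (u - v) w = rdot u w - rdot v w.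
Proof.
rewrite !rdot_sum -sumrN -big_split/=.
by apply: eq_bigr => j _; rewrite !mxE mulrBl.
Qed.

Lemma rdot_conj u v : rdot u v = ((rdot v u)^*)%R.
Proof.
rewrite !rdot_sum rmorph_sum/=; apply: eq_bigr => j _.
by rewrite rmorphM/= conjCK mulrC.
Qed.

Lemma rdotBr u v w : rdot w (u - v) = rdot w u - rdot w v.
Proof. by rewrite rdot_conj rdotBl rmorphB/= -!rdot_conj. Qed.

Lemma rdot_ge0 u : 0 <= rdot u u.
Proof. by rewrite rdot.unlock; exact: dnorm_ge0. Qed.

Lemma rdot_eq0 u : rdot u u = 0 -> u = 0.
Proof. by rewrite rdot.unlock => /eqP; rewrite dnorm_eq0 => /eqP. Qed.

Lemma rdot_rnorm u : rdot u u = (rnorm u ^+ 2)%:C.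
Proof.
rewrite rnorm.unlock sqr_sqrtr ?RRe ?ger0_real ?rdot_ge0//.
by rewrite -C0_le RRe ?ger0_real ?rdot_ge0.
Qed.

Lemma rnorm_ge0 u : 0 <= rnorm u. Proof. by rewrite rnorm.unlock sqrtr_ge0. Qed.

Lemma rnorm_eq0 u : rnorm u = 0 -> u = 0.
Proof. by move=> e; apply: rdot_eq0; rewrite rdot_rnorm e expr0n. Qed.

Lemma sqrtC_rdot u : sqrtC (rdot u u) = (rnorm u)%:C.
Proof.
by rewrite rdot_rnorm expr2 C_M -expr2 sqrCK// C0_le rnorm_ge0.
Qed.

Lemma rnormD u v : rnorm (u + v) <= rnorm u + rnorm v.
Proof.
rewrite -C_le C_D -!sqrtC_rdot rdot.unlock.
by have [] := triangle_lerif (@dotmx R[i] n) u v.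
Qed.

Lemma rnormZ k u : rnorm (k *: u) = cabs k * rnorm u.
Proof.
apply: C_inj; rewrite C_M -!sqrtC_rdot -cabsE.
have -> : rdot (k *: u) (k *: u) = `|k| ^+ 2 * rdot u u.
  rewrite rdot.unlock; exact: (dnormZ (@dotmx R[i] n)).
by rewrite sqrtCM ?nnegrE ?rdot_ge0 ?exprn_ge0// sqrCK.
Qed.

Lemma rnorm0 : rnorm (0 : 'rV[R[i]]_n) = 0.
Proof. by rewrite -(scale0r 0) rnormZ cabs0 mul0r. Qed.

Lemma rnormN u : rnorm (- u) = rnorm u.
Proof. by rewrite -scaleN1r rnormZ cabsN cabs1 mul1r. Qed.

Lemma cabs_rdot u v : cabs (rdot u v) <= rnorm u * rnorm v.
Proof.
rewrite -C_le C_M -!sqrtC_rdot -cabsE rdot.unlock.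
by have [] := CauchySchwarz_sqrt (@dotmx R[i] n) u v.
Qed.

Lemma rnorm_delta (j : 'I_n) : rnorm (delta_mx 0 j : 'rV[R[i]]_n) = 1.
Proof.
apply: (@C_inj R); rewrite -sqrtC_rdot rdot_sum (bigD1 j)//= mxE !eqxx conjC1 mulr1.
rewrite big1 ?addr0 ?sqrtC1// => l lj.
by rewrite mxE (negPf lj) andbF mul0r.
Qed.

Lemma cabs_coord u j : cabs (u 0 j) <= rnorm u.
Proof.
have -> : u 0 j = rdot u (delta_mx 0 j).
  rewrite rdot_sum (bigD1 j)//= mxE !eqxx conjC1 mulr1 big1 ?addr0// => l lj.
  by rewrite mxE (negPf lj) andbF conjC0 mulr0.
by rewrite (le_trans (cabs_rdot _ _))// rnorm_delta mulr1.
Qed.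

Lemma cabs_sum_le (I : finType) (G : I -> R[i]) :
  cabs (\sum_j G j) <= \sum_j cabs (G j).
Proof.
elim/big_ind2: _ => [|x1 x2 y1 y2 h1 h2|//]; first by rewrite cabs0.
by rewrite (le_trans (cabsD _ _))// lerD.
Qed.

Lemma rnorm_le_sum u : rnorm u <= \sum_j cabs (u 0 j).
Proof.
have s0 : 0 <= \sum_j cabs (u 0 j) by apply: sumr_ge0 => j _; exact: cabs_ge0.
rewrite -ler_sqr ?nnegrE ?rnorm_ge0//.
have : cabs (rdot u u) <= (\sum_j cabs (u 0 j)) ^+ 2.
  rewrite rdot_sum expr2 mulr_suml.
  rewrite (le_trans (cabs_sum_le _))//; apply: ler_sum => j _.
  rewrite cabsM cabs_conj ler_wpM2l ?cabs_ge0//.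
  rewrite (bigD1 j)//= lerDl; apply: sumr_ge0 => l _; exact: cabs_ge0.
by rewrite rdot_rnorm cabs_real ger0_norm ?sqr_ge0.
Qed.

End RowVectors.

Section RawLinear.
Variables (R : realType) (V W : lmodType R[i]) (f : V -> W).
Hypothesis lf : linear f.

Lemma rawlinD x y : f (x + y) = f x + f y.
Proof. by have := lf 1 x y; rewrite !scale1r. Qed.

Lemma rawlinB x y : f (x - y) = f x - f y.
Proof.
by have := lf (-1) y x; rewrite !scaleN1r (addrC (- y)) (addrC (- f y)).
Qed.

Lemma rawlin0 : f 0 = 0.
Proof. by rewrite -(subrr 0) rawlinB subrr. Qed.

Lemma rawlinZ (k : R[i]) x : f (k *: x) = k *: f x.
Proof. by have := lf k x 0; rewrite rawlin0 !addr0. Qed.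

End RawLinear.

Lemma linear_row_matrix (R : realType) (n : nat) (f : 'rV[R[i]]_n -> 'rV[R[i]]_n) :
  linear f -> exists M : 'M[R[i]]_n, forall u, u *m M = f u.
Proof.
move=> lf; pose g : {linear 'rV[R[i]]_n -> 'rV[R[i]]_n} :=
  HB.pack f (GRing.isLinear.Build _ _ _ _ f lf).
by exists (lin1_mx g) => u; rewrite mul_rV_lin1.
Qed.

Section Compressions.
Variables (R : realType) (A : unitalCStarAlgType R).
Variables (F : A -> R[i]) (PF : positive_functional F).
Implicit Types (x y z v c : A).

Lemma pfN x : F (- x) = - F x.
Proof. by rewrite -scaleN1r (pfZ PF) mulN1r. Qed.

Lemma pfB x y : F (x - y) = F x - F y.
Proof. by rewrite (pfD PF) pfN. Qed.

Lemma pf0 : F 0 = 0.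
Proof. by rewrite -(scale0r 0) (pfZ PF) mul0r. Qed.

Lemma pf_conj x y : F (cstar x ** y) = (F (cstar y ** x))^*%R.
Proof. by rewrite -(pf_star PF) cstarM cstarK. Qed.

(** With [<x, y> = F (y* x)] as semi-inner product on [A], the map [V] is an
    isometry from a finite-dimensional space into [A] and [J] its adjoint. *)
Record compression (n : nat) (J : A -> 'rV[R[i]]_n) (V : 'rV[R[i]]_n -> A)
    : Prop := {
  comp_linJ : linear J ;
  comp_linV : linear V ;
  comp_adj : forall x u, rdot (J x) u = F (cstar (V u) ** x) ;
  comp_JV : forall u, J (V u) = u
}.

Section CompressionTheory.
Variables (n : nat) (J : A -> 'rV[R[i]]_n) (V : 'rV[R[i]]_n -> A).
Hypothesis JV : compression J V.

(** [V (J x)] is the orthogonal projection of [x], and this is Pythagoras. *)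
Lemma comp_residual x :
  F (cstar (x - V (J x)) ** (x - V (J x))) =
  F (cstar x ** x) - rdot (J x) (J x).
Proof.
have e1 : F (cstar (V (J x)) ** x) = rdot (J x) (J x) by rewrite (comp_adj JV).
have e2 : F (cstar x ** V (J x)) = rdot (J x) (J x).
  by rewrite pf_conj e1 -rdot_conj.
have e3 : F (cstar (V (J x)) ** V (J x)) = rdot (J x) (J x).
  by rewrite -(comp_adj JV) (comp_JV JV).
by rewrite cstarB cmulBl !cmulBr !pfB e1 e2 e3 subrr subr0.
Qed.

Lemma comp_contract x : rdot (J x) (J x) <= F (cstar x ** x).
Proof. by rewrite -subr_ge0 -comp_residual; exact: pf_ge0. Qed.

(** An element whose length is preserved by [J] agrees with its projection up to
    a vector of length zero, and left multiplication keeps such vectors. *)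
Lemma comp_mul_captured c v : rdot (J v) (J v) = F (cstar v ** v) ->
  J (c ** v) = J (c ** V (J v)).
Proof.
move=> cv; apply/eqP; rewrite -subr_eq0; apply/eqP.
rewrite -(rawlinB (comp_linJ JV)) -cmulBr; apply: rdot_eq0; apply/eqP.
rewrite eq_le rdot_ge0 andbT.
rewrite (le_trans (comp_contract _))// (le_trans (pf_contract PF _ _))//.
by rewrite comp_residual cv subrr mulr0.
Qed.

End CompressionTheory.

(** A Gram-Schmidt step: the residual [w] of [v] either has length zero, or is
    normalized to a vector [e] that adds one coordinate. *)
Lemma compression_extend n (J : A -> 'rV[R[i]]_n) V v : compression J V ->
  exists m (J' : A -> 'rV[R[i]]_m) V', [/\ compression J' V',
    rdot (J' v) (J' v) = F (cstar v ** v)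
  & forall x, rdot (J x) (J x) = F (cstar x ** x) ->
      rdot (J' x) (J' x) = F (cstar x ** x)].
Proof.
move=> JV; pose w := v - V (J v); pose om := F (cstar w ** w).
have lJ := comp_linJ JV; have lV := comp_linV JV.
have [om0|omN0] := eqVneq om 0.
  exists n, J, V; split=> //; apply/eqP; rewrite eq_sym -subr_eq0.
  by rewrite -(comp_residual JV) -/w -/om om0.
have om_ge0 : 0 <= om := pf_ge0 PF w.
pose s := sqrtC om; have s_ge0 : 0 <= s by rewrite sqrtC_ge0.
have ss : s * s = om by rewrite -expr2 sqrtCK.
have sN0 : s != 0 by rewrite sqrtC_eq0.
have sVconj : (s^-1^*)%R = s^-1.
  by apply: conj_Creal; apply: ger0_real; rewrite invr_ge0.
pose e := s^-1 *: w.
have Je : J e = 0 by rewrite (rawlinZ lJ) (rawlinB lJ) (comp_JV JV) subrr scaler0.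
have Ve u : F (cstar (V u) ** e) = 0.
  by rewrite -(comp_adj JV) Je rdot_sum big1// => j _; rewrite mxE mul0r.
have eV u : F (cstar e ** V u) = 0 by rewrite pf_conj Ve conjC0.
have es : cstar e = s^-1 *: cstar w by rewrite cstarZ sVconj.
have ee : F (cstar e ** e) = 1.
  rewrite es cmulZl cmulZr !(pfZ PF) -/om -ss mulrA -invfM mulVf//.
  by rewrite mulf_neq0.
pose J' x : 'rV[R[i]]_(n + 1) := row_mx (J x) (F (cstar e ** x))%:M.
pose V' (u : 'rV[R[i]]_(n + 1)) := V (lsubmx u) + rsubmx u 0 0 *: e.
have C' : compression J' V'.
  split.
  - move=> k x y; rewrite /J' scale_row_mx add_row_mx lJ; congr row_mx.
    rewrite cmulDr cmulZr (pfD PF) (pfZ PF).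
    by apply/matrixP => i j; rewrite !ord1 !mxE eqxx !mulr1n.
  - move=> k u u'; rewrite /V' !linearP /= lV !mxE scalerDl -scalerA scalerDr.
    by rewrite addrACA.
  - move=> x u; rewrite /V' cstarD cmulDl (pfD PF) -(comp_adj JV).
    rewrite cstarZ cmulZl (pfZ PF) !rdot_sum big_split_ord/= big_ord1.
    congr (_ + _).
      by apply: eq_bigr => j _; rewrite row_mxEl mxE.
    by rewrite row_mxEr !mxE eqxx mulr1n mulrC.
  - move=> u; rewrite /J' /V'; rewrite -[RHS](hsubmxK u); congr row_mx.
      rewrite addrC lJ Je scaler0 add0r; exact: (comp_JV JV).
    rewrite cmulDr cmulZr (pfD PF) (pfZ PF) eV ee add0r mulr1.
    by apply/matrixP => i j; rewrite !ord1 !mxE eqxx mulr1n.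
exists (n + 1)%N, J', V'; split=> //.
- apply/eqP; rewrite eq_sym -subr_eq0 -(comp_residual C').
  suff -> : v - V' (J' v) = 0 by rewrite cmul0r pf0.
  rewrite /V' /J' row_mxKl row_mxKr mxE eqxx mulr1n.
  have -> : F (cstar e ** v) = s.
    rewrite -(subrK (V (J v)) v) cmulDr (pfD PF) eV addr0 -/w es cmulZl (pfZ PF).
    by rewrite -/om -ss mulKf.
  by rewrite opprD addrA -/w /e scalerA mulfV// scale1r subrr.
- move=> x cx; apply/eqP; rewrite eq_le (comp_contract C')/= -cx.
  rewrite /J' !rdot_sum big_split_ord/= big_ord1 row_mxEr.
  under [X in _ <= X + _]eq_bigr do rewrite row_mxEl.
  by rewrite lerDl mul_conjC_ge0.
Qed.

Lemma compression_exists (s : seq A) :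
  exists n (J : A -> 'rV[R[i]]_n) V, compression J V /\
    forall v, v \in s -> rdot (J v) (J v) = F (cstar v ** v).
Proof.
elim: s => [|v s [n [J [V [JV cap]]]]].
  exists 0, (fun=> 0), (fun=> 0); split=> //; split=> //.
  - by move=> k x y; rewrite scaler0 addr0.
  - by move=> k x y; rewrite scaler0 addr0.
  - by move=> x u; rewrite rdot_sum big_ord0 cstar0 cmul0l pf0.
  - by move=> u; apply/rowP; case.
have [m [J' [V' [JV' capv cap']]]] := compression_extend v JV.
exists m, J', V'; split=> // x; rewrite in_cons => /predU1P[->//|/cap].
exact: cap'.
Qed.

End Compressions.

(** * The algebra of strongly convergent families of matrices *)

(** Finite-dimensional pictures [J i v] of the elements [v] of [A], along a
    filter on the indices [i]. *)
Record pictures (R : realType) (A : unitalCStarAlgType R) : Type := Pictures {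
  pic_idx : Type ;
  pic_dim : pic_idx -> nat ;
  pic : forall i, A -> 'rV[R[i]]_(pic_dim i) ;
  pic_ev : set_system pic_idx ;
  pic_filter : ProperFilter pic_ev ;
  pic_linear : forall i, linear (pic i) ;
  pic_bound : A -> R ;
  pic_boundP : forall i c v, rnorm (pic i (c ** v)) <= nrm c * pic_bound v
}.

#[local] Existing Instance pic_filter.

Definition op_family (R : realType) (A : unitalCStarAlgType R) (S : pictures A)
  : Type := forall i : pic_idx S, 'M[R[i]]_(pic_dim i).

Section OpFamily.
Variables (R : realType) (A : unitalCStarAlgType R) (S : pictures A).
Implicit Types (T U V : op_family S).

HB.instance Definition _ := gen_eqMixin (op_family S).
HB.instance Definition _ := gen_choiceMixin (op_family S).

Lemma op_familyP T U : (forall i, T i = U i) -> T = U.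
Proof. exact: functional_extensionality_dep. Qed.

Definition opf_zero : op_family S := fun i => 0.
Definition opf_opp T : op_family S := fun i => - T i.
Definition opf_add T U : op_family S := fun i => T i + U i.

Fact opf_addA : associative opf_add.
Proof. by move=> T U V; apply: op_familyP => i; exact: addrA. Qed.
Fact opf_addC : commutative opf_add.
Proof. by move=> T U; apply: op_familyP => i; exact: addrC. Qed.
Fact opf_add0 : left_id opf_zero opf_add.
Proof. by move=> T; apply: op_familyP => i; exact: add0r. Qed.
Fact opf_addN : left_inverse opf_zero opf_opp opf_add.
Proof. by move=> T; apply: op_familyP => i; exact: addNr. Qed.

HB.instance Definition _ :=
  GRing.isZmodule.Build (op_family S) opf_addA opf_addC opf_add0 opf_addN.

Definition opf_scale (k : R[i]) T : op_family S := fun i => k *: T i.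

Fact opf_scaleA (a b : R[i]) T : opf_scale a (opf_scale b T) = opf_scale (a * b) T.
Proof. by apply: op_familyP => i; rewrite /opf_scale scalerA. Qed.
Fact opf_scale1 : left_id 1 opf_scale.
Proof. by move=> T; apply: op_familyP => i; rewrite /opf_scale scale1r. Qed.
Fact opf_scaleDr : right_distributive opf_scale +%R.
Proof. by move=> a T U; apply: op_familyP => i; exact: scalerDr. Qed.
Fact opf_scaleDl T : {morph (fun a => opf_scale a T) : a b / a + b}.
Proof. by move=> a b; apply: op_familyP => i; exact: scalerDl. Qed.

HB.instance Definition _ := GRing.Zmodule_isLmodule.Build R[i] (op_family S)
  opf_scaleA opf_scale1 opf_scaleDr opf_scaleDl.

End OpFamily.

Section Adjoint.
Variables (R : realType) (n : nat).
Implicit Types (M N : 'M[R[i]]_n) (u v : 'rV[R[i]]_n).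

Definition adjm M : 'M[R[i]]_n := map_mx (@Num.conj R[i]) M^T.

Lemma adjmK : involutive adjm.
Proof. by move=> M; apply/matrixP => i j; rewrite !mxE conjCK. Qed.

Lemma adjmM M N : adjm (M *m N) = adjm N *m adjm M.
Proof. by rewrite /adjm trmx_mul map_mxM. Qed.

Lemma adjmD M N : adjm (M + N) = adjm M + adjm N.
Proof. by rewrite /adjm !linearD /= map_mxD. Qed.

Lemma adjmZ (k : R[i]) M : adjm (k *: M) = (k^*)%R *: adjm M.
Proof. by rewrite /adjm linearZ /= map_mxZ. Qed.

Lemma adjm1 : adjm 1%:M = 1%:M.
Proof. by rewrite /adjm trmx1 map_mx1. Qed.

Lemma rdot_adjm M u v : rdot (u *m M) v = rdot u (v *m adjm M).
Proof.
rewrite rdot.unlock !dotmxE trmx_mul map_mxM mulmxA; congr ((_ *m _ *m _) 0 0).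
by apply/matrixP => i j; rewrite !mxE; exact: esym (conjCK _).
Qed.

(** [|u M*|^2 = <u M* M, u>], which is at most [r |u M*| |u|]. *)
Lemma adjm_bound M r : 0 <= r -> (forall u, rnorm (u *m M) <= r * rnorm u) ->
  forall u, rnorm (u *m adjm M) <= r * rnorm u.
Proof.
move=> r0 h u; have [->|N0] := eqVneq (rnorm (u *m adjm M)) 0.
  by rewrite mulr_ge0// rnorm_ge0.
have p : 0 < rnorm (u *m adjm M) by rewrite lt_neqAle eq_sym N0 rnorm_ge0.
rewrite -(ler_pM2r p) -expr2.
have -> : rnorm (u *m adjm M) ^+ 2 = cabs (rdot (u *m adjm M *m M) u).
  by rewrite rdot_adjm rdot_rnorm cabs_real ger0_norm// sqr_ge0.
rewrite (le_trans (cabs_rdot _ _))// mulrAC ler_wpM2r ?rnorm_ge0//.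
Qed.

Lemma entry_le_bound M r : (forall u, rnorm (u *m M) <= r * rnorm u) ->
  forall k j, cabs (M k j) <= r.
Proof.
move=> h k j; have := h (delta_mx 0 k); rewrite rnorm_delta mulr1.
by apply: le_trans; rewrite -rowE (le_trans _ (cabs_coord _ j))// mxE.
Qed.

(** In finite dimension finitely many entries control the norm. *)
Lemma matrix_entry_cvg (T : nat -> 'M[R[i]]_n) (L : 'M[R[i]]_n) u :
  (forall k j (e : R), 0 < e -> exists m0, forall m, (m0 <= m)%N ->
     cabs (L k j - T m k j) <= e) ->
  forall e : R, 0 < e -> exists m0, forall m, (m0 <= m)%N ->
    rnorm (u *m (L - T m)) <= e.
Proof.
move=> cv e e0; pose K := \sum_(j < n) \sum_(k < n) cabs (u 0 k).
have K0 : 0 <= K by do 2!(apply: sumr_ge0 => ? _); exact: cabs_ge0.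
pose d := e / (K + 1).
have K1 : 0 < K + 1 by rewrite ltr_wpDl.
have d0 : 0 < d by rewrite divr_gt0.
pose m_ k j := projT1 (cid (cv k j d d0)).
have Hm k j m : (m_ k j <= m)%N -> cabs (L k j - T m k j) <= d.
  exact: (projT2 (cid (cv k j d d0))).
exists (\max_(k < n) \max_(j < n) m_ k j)%N => m mm.
have le : rnorm (u *m (L - T m)) <= K * d.
  rewrite (le_trans (rnorm_le_sum _))// mulr_suml; apply: ler_sum => j _.
  rewrite mxE (le_trans (cabs_sum_le _))// mulr_suml; apply: ler_sum => k _.
  rewrite cabsM ler_wpM2l ?cabs_ge0// !mxE Hm// (leq_trans _ mm)//.
  apply: (leq_trans _ (leq_bigmax k)) => /=.
  exact: (leq_bigmax (F := fun j => m_ k j) j).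
rewrite (le_trans le)// /d mulrCA ger_pMr// ler_pdivrMr// mul1r.
by rewrite lerDl ler01.
Qed.

End Adjoint.

Section StrongPairs.
Variables (R : realType) (A : unitalCStarAlgType R) (S : pictures A).
Implicit Types (x y z : op_family S * A) (r s : R) (c v : A).

Local Notation J := (@pic R A S).
Local Notation ev := (@pic_ev R A S).

(** Matrices act on row vectors from the right, whence the reversed product. *)
Definition pmul x y : op_family S * A := ((fun i => y.1 i *m x.1 i), x.2 ** y.2).
Definition pstar x : op_family S * A := ((fun i => adjm (x.1 i)), cstar x.2).
Definition pone : op_family S * A := ((fun i => 1%:M), cone).

Definition op_bound r (T : op_family S) :=
  forall i u, rnorm (u *m T i) <= r * rnorm u.

(** The matrices of [x] converge strongly to left multiplication by its second
    component. *)
Definition strong_lim x := forall v (e : R), 0 < e ->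
  ev [set i | rnorm (J i v *m x.1 i - J i (x.2 ** v)) <= e].

Definition strong_pair x :=
  [/\ exists2 r, 0 <= r & op_bound r x.1, strong_lim x & strong_lim (pstar x)].

Lemma pictureD i v w : J i (v + w) = J i v + J i w.
Proof. exact: rawlinD (pic_linear i) _ _. Qed.

Lemma pictureB i v w : J i (v - w) = J i v - J i w.
Proof. exact: rawlinB (pic_linear i) _ _. Qed.

Lemma pictureZ i k v : J i (k *: v) = k *: J i v.
Proof. exact: rawlinZ (pic_linear i) _ _. Qed.

Lemma op_boundD r s T U : op_bound r T -> op_bound s U -> op_bound (r + s) (T + U).
Proof.
move=> hT hU i u; rewrite -[(T + U) i]/(T i + U i) mulmxDr (le_trans (rnormD _ _))//.
by rewrite mulrDl lerD.
Qed.

Lemma op_boundZ r k T : op_bound r T -> op_bound (cabs k * r) (k *: T).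
Proof.
move=> hT i u; rewrite -[(k *: T) i]/(k *: T i) -scalemxAr rnormZ -mulrA.
by rewrite ler_wpM2l ?cabs_ge0.
Qed.

Lemma op_boundM r s x y : 0 <= r -> op_bound r x.1 -> op_bound s y.1 ->
  op_bound (r * s) (pmul x y).1.
Proof.
move=> r0 hx hy i u; rewrite /= mulmxA (le_trans (hx i _))// -mulrA.
by rewrite ler_wpM2l.
Qed.

Lemma op_bound_star r x : 0 <= r -> op_bound r x.1 -> op_bound r (pstar x).1.
Proof. by move=> r0 hx i u; apply: adjm_bound. Qed.

Lemma strong_limD x y : strong_lim x -> strong_lim y -> strong_lim (x + y).
Proof.
move=> hx hy v e e0; have e2 : 0 < e / 2 by rewrite divr_gt0.
apply: filterS (filterI (hx v _ e2) (hy v _ e2)) => i [/= h1 h2].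
rewrite -[(x.1 + y.1) i]/(x.1 i + y.1 i) mulmxDr cmulDl pictureD opprD addrACA.
by rewrite (splitr e) (le_trans (rnormD _ _))// lerD.
Qed.

Lemma strong_limZ k x : strong_lim x -> strong_lim (k *: x).
Proof.
move=> hx v e e0; pose d := e / (cabs k + 1).
have k1 : 0 < cabs k + 1 by rewrite ltr_wpDl// cabs_ge0.
have d0 : 0 < d by rewrite divr_gt0.
apply: filterS (hx v _ d0) => i /= h.
rewrite -[(k *: x.1) i]/(k *: x.1 i) -scalemxAr cmulZl pictureZ -scalerBr rnormZ.
rewrite (le_trans (ler_wpM2l (cabs_ge0 k) h))// /d mulrCA ger_pMr//.
by rewrite ler_pdivrMr// mul1r lerDl ler01.
Qed.

(** [S T v - c d v = (S - c) (d v) + S (T - d) v], where [S] stays bounded. *)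
Lemma strong_limM r x y : op_bound r x.1 -> 0 <= r ->
  strong_lim x -> strong_lim y -> strong_lim (pmul x y).
Proof.
move=> bx r0 hx hy v e e0; pose d := e / (r + 1).
have r1 : 0 < r + 1 by rewrite ltr_wpDl.
have d0 : 0 < d by rewrite divr_gt0.
apply: filterS (filterI (hx (y.2 ** v) _ d0) (hy v _ d0)) => i [/= h1 h2].
have -> : J i v *m (y.1 i *m x.1 i) - J i (x.2 ** y.2 ** v) =
  (J i v *m y.1 i - J i (y.2 ** v)) *m x.1 i +
  (J i (y.2 ** v) *m x.1 i - J i (x.2 ** (y.2 ** v))).
  by rewrite mulmxBl addrA subrK mulmxA cmulA.
rewrite (le_trans (rnormD _ _))//.
have -> : e = r * d + d by rewrite /d; field; rewrite gt_eqF.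
by rewrite lerD// (le_trans (bx i _))// ler_wpM2l.
Qed.

(** The error splits into three parts; the two that come from [x - y] are small
    uniformly in the index because [pic_bound] does not depend on it. *)
Lemma strong_lim_closed x :
  (forall e : R, 0 < e -> exists y,
     [/\ strong_lim y, op_bound e (x - y).1 & nrm (x - y).2 <= e]) ->
  strong_lim x.
Proof.
move=> hx v e e0.
pose W := Num.max 0 (pic_bound S v).
have Wge : pic_bound S v <= W by rewrite le_max lexx orbT.
have Wge0 : 0 <= W by rewrite le_max lexx.
have JW i c : rnorm (J i (c ** v)) <= nrm c * W.
  by rewrite (le_trans (pic_boundP i c v))// ler_wpM2l ?nrm_ge0.
pose K := nrm (cone : A) * W + 1 + W.
have K1 : 0 < K.
  by rewrite /K ltr_wpDr// ltr_wpDl// mulr_ge0 ?nrm_ge0.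
pose d := e / K; have d0 : 0 < d by rewrite divr_gt0.
have eE : e = K * d by rewrite mulrC divfK// gt_eqF.
clearbody d; have [y [ly by1 by2]] := hx _ d0.
apply: filterS (ly v _ d0) => i /= h.
have -> : J i v *m x.1 i - J i (x.2 ** v) =
  J i v *m (x.1 i - y.1 i) + (J i v *m y.1 i - J i (y.2 ** v)) -
  J i ((x.2 - y.2) ** v).
  by rewrite mulmxBr addrA subrK cmulBl pictureB opprB addrA subrK.
rewrite (le_trans (rnormD _ _))// rnormN.
rewrite eE /K mulrDl mulrDl mul1r.
apply: lerD; last by rewrite (le_trans (JW i _))// mulrC ler_wpM2l.
rewrite (le_trans (rnormD _ _))// lerD//.
rewrite (le_trans (by1 i _))// mulrC ler_wpM2r ?(ltW d0)//.
by rewrite -{1}(cmul1l v).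
Qed.

Lemma pstarD x y : pstar (x + y) = pstar x + pstar y.
Proof.
congr (_, _); last exact: cstarD.
by apply: op_familyP => i; exact: adjmD.
Qed.

Lemma pstarZ (k : R[i]) x : pstar (k *: x) = (k^*)%R *: pstar x.
Proof.
congr (_, _); last exact: cstarZ.
by apply: op_familyP => i; exact: adjmZ.
Qed.

Lemma pstarN x : pstar (- x) = - pstar x.
Proof. by rewrite -scaleN1r pstarZ rmorphN /= conjC1 scaleN1r. Qed.

Lemma pstarM x y : pstar (pmul x y) = pmul (pstar y) (pstar x).
Proof.
congr (_, _); last exact: cstarM.
by apply: op_familyP => i; exact: adjmM.
Qed.

Lemma pstarK : involutive pstar.
Proof.
move=> [T c]; congr (_, _); last exact: cstarK.
by apply: op_familyP => i; exact: adjmK.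
Qed.

Lemma pmulA : associative pmul.
Proof.
move=> x y z; congr (_, _); last exact: cmulA.
by apply: op_familyP => i /=; rewrite mulmxA.
Qed.

Lemma pmulDl : left_distributive pmul +%R.
Proof.
move=> x y z; congr (_, _); last exact: cmulDl.
by apply: op_familyP => i; exact: mulmxDr.
Qed.

Lemma pmulDr : right_distributive pmul +%R.
Proof.
move=> x y z; congr (_, _); last exact: cmulDr.
by apply: op_familyP => i; exact: mulmxDl.
Qed.

Lemma pmulZl (k : R[i]) x y : pmul (k *: x) y = k *: pmul x y.
Proof.
congr (_, _); last exact: cmulZl.
by apply: op_familyP => i; rewrite /= -scalemxAr.
Qed.

Lemma pmulZr (k : R[i]) x y : pmul x (k *: y) = k *: pmul x y.
Proof.
congr (_, _); last exact: cmulZr.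
by apply: op_familyP => i; rewrite /= -scalemxAl.
Qed.

Lemma strong_pairD x y : strong_pair x -> strong_pair y -> strong_pair (x + y).
Proof.
move=> [[r r0 bx] lx sx] [[s s0 bY] ly sy]; split.
- by exists (r + s); [exact: addr_ge0 | exact: op_boundD].
- exact: strong_limD.
- by rewrite pstarD; exact: strong_limD.
Qed.

Lemma strong_pairZ k x : strong_pair x -> strong_pair (k *: x).
Proof.
move=> [[r r0 bx] lx sx]; split.
- by exists (cabs k * r); [rewrite mulr_ge0 ?cabs_ge0 | exact: op_boundZ].
- exact: strong_limZ.
- by rewrite pstarZ; exact: strong_limZ.
Qed.

Lemma strong_pairM x y : strong_pair x -> strong_pair y -> strong_pair (pmul x y).
Proof.
move=> [[r r0 bx] lx sx] [[s s0 bY] ly sy]; split.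
- by exists (r * s); [exact: mulr_ge0 | exact: op_boundM].
- exact: (strong_limM bx).
- by rewrite pstarM; apply: (strong_limM (op_bound_star s0 bY)).
Qed.

Lemma strong_pair_star x : strong_pair x -> strong_pair (pstar x).
Proof.
move=> [[r r0 bx] lx sx]; split=> //; last by rewrite pstarK.
by exists r => //; exact: op_bound_star.
Qed.

Lemma pstar1 : pstar pone = pone.
Proof.
congr (_, _); last exact: cstar1.
by apply: op_familyP => i; exact: adjm1.
Qed.

Lemma strong_pair1 : strong_pair pone.
Proof.
have l1 : strong_lim pone.
  move=> v e e0; apply: nearW => i /=.
  by rewrite mulmx1 cmul1l subrr rnorm0 ltW.
split=> //; last by rewrite pstar1.
by exists 1 => // i u; rewrite /= mulmx1 mul1r.
Qed.

Lemma strong_pair0 : strong_pair 0.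
Proof. by rewrite -(scale0r pone); apply/strong_pairZ/strong_pair1. Qed.

Definition strong_pred : pred (op_family S * A) := fun x => `[< strong_pair x >].

Lemma strong_pred_closed : submod_closed strong_pred.
Proof.
split; first by apply/asboolP/strong_pair0.
move=> k x y /asboolP hx /asboolP hy; apply/asboolP.
by apply: strong_pairD => //; exact: strong_pairZ.
Qed.

HB.instance Definition _ := GRing.isSubmodClosed.Build _ _ strong_pred
  strong_pred_closed.

End StrongPairs.

Definition strong_alg (R : realType) (A : unitalCStarAlgType R) (S : pictures A)
  : Type := {x : op_family S * A | strong_pred x}.

Section StrongAlgebra.
Variables (R : realType) (A : unitalCStarAlgType R) (S : pictures A).
Local Notation B := (strong_alg S).

HB.instance Definition _ := SubType.copy B {x : op_family S * A | strong_pred x}.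
HB.instance Definition _ := [Choice of B by <:].
HB.instance Definition _ := [SubChoice_isSubLmodule of B by <:].

Implicit Types (a b : B) (r s : R).

Lemma strongP b : strong_pair (val b).
Proof. by have /asboolP := valP b. Qed.

Definition strong_of (x : op_family S * A) (h : strong_pair x) : B :=
  Sub x (introT (asboolP _) h).

Definition strong_mul a b : B := strong_of (strong_pairM (strongP a) (strongP b)).
Definition strong_star a : B := strong_of (strong_pair_star (strongP a)).
Definition strong_one : B := strong_of (strong_pair1 S).

Definition strong_bnd r b :=
  [/\ 0 <= r, op_bound r (val b).1 & nrm (val b).2 <= r].

Lemma strong_norm_bounds : norm_bounds strong_bnd.
Proof.
split.
- by move=> r b [].
- move=> r b h; split.
  + by apply/ler_addgt0Pr => e /h[].
  + move=> i u; apply/ler_addgt0Pr => e e0.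
    pose d := e / (rnorm u + 1).
    have bp : 0 < rnorm u + 1 by rewrite ltr_wpDl// rnorm_ge0.
    have [|_ /(_ i u)/le_trans + _] := h d; first by rewrite divr_gt0.
    apply; rewrite mulrDl lerD2l /d mulrAC ler_pdivrMr// ler_pM2l//.
    by rewrite lerDl ler01.
  + by apply/ler_addgt0Pr => e /h[].
- move=> r s b [r0 h1 h2] rs; split; [exact: le_trans rs| |exact: le_trans rs].
  by move=> i u; rewrite (le_trans (h1 i u))// ler_wpM2r// rnorm_ge0.
- move=> b; have [[r r0 h] _ _] := strongP b.
  exists (Num.max r (nrm (val b).2)); split.
  + by rewrite le_max r0.
  + by move=> i u; rewrite (le_trans (h i u))// ler_wpM2r ?rnorm_ge0// le_max lexx.
  + by rewrite le_max lexx orbT.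
- move=> b [_ h1 h2]; apply: val_inj; rewrite raddf0.
  rewrite [val b]surjective_pairing; congr (_, _).
    apply: op_familyP => i; apply/row_matrixP => k; rewrite rowE [RHS]rowE mulmx0.
    by apply/rnorm_eq0/eqP; rewrite eq_le rnorm_ge0 andbT (le_trans (h1 _ _))// mul0r.
  by apply/nrm_eq0/eqP; rewrite eq_le nrm_ge0 andbT.
- move=> r s a b [r0 h1 h2] [s0 k1 k2]; split; first exact: addr_ge0.
    by rewrite raddfD /=; exact: op_boundD.
  by rewrite raddfD /= (le_trans (nrmD _ _))// lerD.
- move=> r k b [r0 h1 h2]; split; first by rewrite mulr_ge0// cabs_ge0.
    by rewrite linearZ /=; exact: op_boundZ.
  by rewrite linearZ /= nrmZ ler_wpM2l// cabs_ge0.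
Qed.

HB.instance Definition _ := @Lmodule_isNormed.Build R[i] B
  (fun b => (norm_of_bounds strong_bnd b)%:C)
  (norm_of_boundsD strong_norm_bounds) (norm_of_boundsZ strong_norm_bounds)
  (norm_of_bounds_eq0 strong_norm_bounds).

Lemma strong_nrmP b r : nrm b <= r <-> strong_bnd r b.
Proof. exact: (norm_of_boundsP strong_norm_bounds). Qed.

Lemma strong_valB a b i :
  (val (a - b)).1 i = (val a).1 i - (val b).1 i.
Proof. by rewrite raddfB. Qed.

(** Entries of the matrices converge since a bound on a matrix bounds its
    entries; the convergence is uniform in the index, as a Cauchy bound
    for each vector survives in the limit. *)
Lemma strong_complete (F : set_system B) : ProperFilter F -> cauchy F -> cvg F.
Proof.
apply: complete_of_cauchy_seq => u cu.
have entry i k j : exists l, forall e : R, 0 < e -> exists N, forall n,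
    (N <= n)%N -> cabs (l - (val (u n)).1 i k j) <= e.
  apply: complex_cauchy_seq_cvg => e /cu[N HN]; exists N => m n hm hn.
  have /strong_nrmP[_ h _] := HN _ _ hm hn.
  by have := entry_le_bound (h i) k j; rewrite strong_valB !mxE.
pose T : op_family S := fun i => \matrix_(k, j) projT1 (cid (entry i k j)).
have HT i k j := projT2 (cid (entry i k j)).
have [|c /nrm_cvgP Hc] := @cauchy_seq_cvg R A (fun n => (val (u n)).2).
  move=> e /cu[N HN]; exists N => m n hm hn.
  by have /strong_nrmP[_ _] := HN _ _ hm hn; rewrite raddfB.
pose x : op_family S * A := (T, c).
have main (e : R) : 0 < e -> exists N, forall n, (N <= n)%N ->
    op_bound e (x - val (u n)).1 /\ nrm (x - val (u n)).2 <= e.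
  move=> e0; have [N HN] := cu _ e0; have [M HM] := Hc _ e0.
  exists (maxn N M) => n; rewrite geq_max => /andP[nN nM]; split; last exact: HM.
  move=> i w; apply/ler_addgt0Pr => d d0.
  have [|m0 Hm] := @matrix_entry_cvg R _ (fun m => (val (u m)).1 i) (T i) w _ _ d0.
    move=> k j d' d'0; have [m0 Hm] := HT i k j _ d'0; exists m0 => m mm.
    by rewrite mxE; exact: Hm.
  pose m := maxn N m0.
  have /strong_nrmP[_ h _] := HN m n (leq_maxl _ _) nN.
  have -> : w *m (x - val (u n)).1 i =
      w *m (val (u m - u n)).1 i + w *m (T i - (val (u m)).1 i).
    by rewrite strong_valB -mulmxDr [X in _ = _ *m X]addrC subrKA.
  by rewrite (le_trans (rnormD _ _))// lerD// Hm// leq_maxr.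
have sx : strong_pair x.
  split.
  - have [N /(_ _ (leqnn _))[h _]] := main 1 ltr01.
    have [[r r0 br] _ _] := strongP (u N).
    exists (1 + r); first exact: addr_ge0.
    by rewrite -(subrK (val (u N)) x); exact: op_boundD.
  - apply: strong_lim_closed => e /main[N /(_ _ (leqnn _))[h1 h2]].
    by exists (val (u N)); split=> //; have [] := strongP (u N).
  - apply: strong_lim_closed => e e0; have [N /(_ _ (leqnn _))[h1 h2]] := main _ e0.
    exists (pstar (val (u N))); rewrite -pstarN -pstarD; split.
    + by have [] := strongP (u N).
    + exact: op_bound_star (ltW e0) h1.
    + by rewrite /= nrm_cstar.
exists (strong_of sx); apply/nrm_cvgP => e e0; have [N HN] := main _ e0.
exists N => n /HN[h1 h2]; apply/strong_nrmP; split; first exact: ltW.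
  by rewrite raddfB.
by rewrite raddfB.
Qed.

HB.instance Definition _ := Uniform_isComplete.Build B strong_complete.

Lemma strong_mulA : associative strong_mul.
Proof. by move=> a b c; apply: val_inj; exact: pmulA. Qed.

Lemma strong_valD a b : val (a + b) = val a + val b.
Proof. exact: raddfD. Qed.

Lemma strong_valZ (k : R[i]) a : val (k *: a) = k *: val a.
Proof. exact: linearZ. Qed.

Lemma strong_val_mul a b : val (strong_mul a b) = pmul (val a) (val b).
Proof. by []. Qed.

Lemma strong_val_star a : val (strong_star a) = pstar (val a).
Proof. by []. Qed.

Lemma strong_mulDl : left_distributive strong_mul +%R.
Proof.
move=> a b c; apply: val_inj.
by rewrite strong_valD !strong_val_mul strong_valD pmulDl.
Qed.

Lemma strong_mulDr : right_distributive strong_mul +%R.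
Proof.
move=> a b c; apply: val_inj.
by rewrite strong_valD !strong_val_mul strong_valD pmulDr.
Qed.

Lemma strong_mulZl (k : R[i]) a b : strong_mul (k *: a) b = k *: strong_mul a b.
Proof.
by apply: val_inj; rewrite strong_valZ !strong_val_mul strong_valZ pmulZl.
Qed.

Lemma strong_mulZr (k : R[i]) a b : strong_mul a (k *: b) = k *: strong_mul a b.
Proof.
by apply: val_inj; rewrite strong_valZ !strong_val_mul strong_valZ pmulZr.
Qed.

Lemma strong_starD : {morph strong_star : a b / a + b}.
Proof.
move=> a b; apply: val_inj.
by rewrite strong_valD !strong_val_star strong_valD pstarD.
Qed.

Lemma strong_starZ (k : R[i]) a : strong_star (k *: a) = (k^*)%R *: strong_star a.
Proof.
by apply: val_inj; rewrite strong_valZ !strong_val_star strong_valZ pstarZ.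
Qed.

Lemma strong_starM a b :
  strong_star (strong_mul a b) = strong_mul (strong_star b) (strong_star a).
Proof. by apply: val_inj; exact: pstarM. Qed.

Lemma strong_starK : involutive strong_star.
Proof. by move=> a; apply: val_inj; exact: pstarK. Qed.

Lemma strong_normM a b : nrm (strong_mul a b) <= nrm a * nrm b.
Proof.
have /strong_nrmP[r0 h1 h2] := lexx (nrm a).
have /strong_nrmP[s0 k1 k2] := lexx (nrm b).
apply/strong_nrmP; split; first exact: mulr_ge0.
  exact: op_boundM.
by rewrite (le_trans (nrmM _ _))// ler_pM ?nrm_ge0.
Qed.

Lemma strong_norm_star_le a : nrm a ^+ 2 <= nrm (strong_mul (strong_star a) a).
Proof.
set s := nrm (strong_mul _ _); have s0 : 0 <= s := nrm_ge0 _.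
have /strong_nrmP[_ h1 h2] := lexx s.
rewrite -[leRHS](sqr_sqrtr s0) ler_sqr ?nnegrE ?sqrtr_ge0 ?nrm_ge0//.
apply/strong_nrmP; split; first exact: sqrtr_ge0.
- move=> i u; apply: le_sqrt_mul => //; first exact: rnorm_ge0.
  have := cabs_rdot (u *m ((val a).1 i *m adjm ((val a).1 i))) u.
  rewrite mulmxA; have -> : rdot (u *m (val a).1 i *m adjm ((val a).1 i)) u =
      rdot (u *m (val a).1 i) (u *m (val a).1 i).
    by rewrite rdot_adjm adjmK.
  rewrite rdot_rnorm cabs_real ger0_norm ?sqr_ge0// => /le_trans; apply.
  rewrite expr2 mulrA ler_wpM2r ?rnorm_ge0// -mulmxA.
  exact: h1.
- rewrite -[leRHS]mulr1; apply: le_sqrt_mul => //.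
  by rewrite expr1n mulr1 -nrm_cstarM.
Qed.

Lemma strong_cnormM_le a b : `|strong_mul a b| <= `|a| * `|b|.
Proof. by rewrite !nrmE -C_M C_le strong_normM. Qed.

Lemma strong_cnorm_cstar a : `|strong_mul (strong_star a) a| = `|a| ^+ 2.
Proof.
rewrite !nrmE (cstar_identity _ (@nrm_ge0 _ _) strong_starK strong_normM strong_norm_star_le).
by rewrite !expr2 C_M.
Qed.

HB.instance Definition _ := isCStarAlgebra.Build R B
  strong_mulA strong_mulDl strong_mulDr strong_mulZl strong_mulZr strong_starD
  strong_starZ strong_starM strong_starK strong_cnormM_le strong_cnorm_cstar.

Lemma strong_mul1l : left_id strong_one strong_mul.
Proof.
move=> a; apply: val_inj => /=; rewrite [RHS]surjective_pairing; congr (_, _).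
  by apply: op_familyP => i; rewrite /= mulmx1.
exact: cmul1l.
Qed.

Lemma strong_mul1r : right_id strong_one strong_mul.
Proof.
move=> a; apply: val_inj => /=; rewrite [RHS]surjective_pairing; congr (_, _).
  by apply: op_familyP => i; rewrite /= mul1mx.
exact: cmul1r.
Qed.

HB.instance Definition _ :=
  CStarAlgebra_isUnital.Build R B strong_mul1l strong_mul1r.

Definition strong_limit b : A := (val b).2.

Lemma strong_limit_hom : unital_star_hom (strong_limit : B -> A).
Proof.
by split=> //; split.
Qed.

Definition row_dot n : {dot 'rV[R[i]]_n for (@Num.conj R[i])} := @dotmx R[i] n.

Definition strong_coord i b : 'End('rV[R[i]]_(pic_dim i)) :=
  linfun (mulmxr ((val b).1 i)).

Lemma strong_coordE (i : pic_idx S) b u : strong_coord i b u = u *m (val b).1 i.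
Proof. by rewrite lfunE. Qed.

Lemma strong_coord_rep (D : cstarAlgType R) (phi : D -> B) (i : pic_idx S) :
  star_hom phi ->
  fd_representation (row_dot (pic_dim i)) (fun d => strong_coord i (phi d)).
Proof.
move=> [lphi mphi sphi]; split.
- move=> k a b; apply/lfunP => u; rewrite lphi add_lfunE scale_lfunE !strong_coordE.
  rewrite strong_valD strong_valZ scalemxAr -mulmxDr; congr (_ *m _).
- move=> a b; apply/lfunP => u; rewrite comp_lfunE !strong_coordE mphi /=.
  by rewrite mulmxA.
- move=> a u v; rewrite !strong_coordE sphi.
  by have := rdot_adjm ((val (phi a)).1 i) u v; rewrite rdot.unlock.
Qed.

End StrongAlgebra.

(** * Lifting through compressions *)

Section CompressionPictures.
Variables (R : realType) (A : unitalCStarAlgType R).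
Variables (F : A -> R[i]) (PF : positive_functional F).
Implicit Types (c v x y : A) (s : seq A).

Definition comp_dim s : nat := projT1 (cid (compression_exists PF s)).
Definition comp_J s : A -> 'rV[R[i]]_(comp_dim s) :=
  projT1 (cid (projT2 (cid (compression_exists PF s)))).
Definition comp_V s : 'rV[R[i]]_(comp_dim s) -> A :=
  projT1 (cid (projT2 (cid (projT2 (cid (compression_exists PF s)))))).

Lemma comp_spec s : compression F (comp_J s) (@comp_V s) /\
  forall v, v \in s -> rdot (comp_J s v) (comp_J s v) = F (cstar v ** v).
Proof.
exact: (projT2 (cid (projT2 (cid (projT2 (cid (compression_exists PF s))))))).
Qed.

Definition pf_norm v : R := Num.sqrt (complex.Re (F (cstar v ** v))).

Lemma pf_normE v : F (cstar v ** v) = (pf_norm v ^+ 2)%:C.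
Proof.
have h := pf_ge0 PF v.
rewrite sqr_sqrtr ?RRe ?ger0_real//.
by rewrite -C0_le RRe ?ger0_real.
Qed.

Lemma pf_norm_ge0 v : 0 <= pf_norm v.
Proof. exact: sqrtr_ge0. Qed.

Lemma pf_norm_contract c v : pf_norm (c ** v) <= nrm c * pf_norm v.
Proof.
rewrite -ler_sqr ?nnegrE ?mulr_ge0 ?pf_norm_ge0 ?nrm_ge0//.
by rewrite exprMn -C_le (C_M (nrm c ^+ 2)) -!pf_normE; exact: pf_contract.
Qed.

Lemma pf_normB_le x y :
  pf_norm x ^+ 2 <= 2 * (pf_norm (x - y) ^+ 2 + pf_norm y ^+ 2).
Proof.
have [z xz] : exists z, x = z + y by exists (x - y); rewrite subrK.
rewrite xz addrK; have := pf_ge0 PF (z - y).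
have -> : F (cstar (z - y) ** (z - y)) =
    2 * (F (cstar z ** z) + F (cstar y ** y)) - F (cstar (z + y) ** (z + y)).
  rewrite cstarB cstarD !(cmulBl, cmulDl) !(cmulBr, cmulDr).
  by rewrite !(pfD PF) !(pfN PF) !(pfD PF) !(pfN PF); ring.
by rewrite !pf_normE -(C_nat R 2) -C_D -C_M -C_N -C_D C0_le subr_ge0.
Qed.

Lemma comp_J_norm s v : rnorm (comp_J s v) <= pf_norm v.
Proof.
have [h _] := comp_spec s.
rewrite -ler_sqr ?nnegrE ?rnorm_ge0 ?pf_norm_ge0//.
by rewrite -C_le -rdot_rnorm -pf_normE; exact: comp_contract h _.
Qed.

(** The lists containing a given list: a directed family, since two lists have
    their concatenation as upper bound. *)
Definition superlists : set_system (seq A) :=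
  filter_from [set: seq A] (fun s0 => [set s : seq A | {subset s0 <= s}]).

Lemma superlists_proper : ProperFilter superlists.
Proof.
apply: filter_from_proper => [|s _]; last by exists s => v.
apply: filter_from_filter => [|s t _ _]; first by exists [::].
exists (s ++ t) => // w /= st; split=> v vs; apply: st; rewrite mem_cat vs ?orbT//.
Qed.

Lemma superlists_mem v : superlists [set s : seq A | v \in s].
Proof. by exists [:: v] => // s /= h; apply: h; rewrite inE. Qed.

Definition comp_pictures : pictures A :=
  @Pictures R A (seq A) comp_dim comp_J superlists superlists_proper
    (fun s => comp_linJ (comp_spec s).1) pf_norm
    (fun s c v => le_trans (comp_J_norm s (c ** v)) (pf_norm_contract c v)).

(** The truncation [J c V] of left multiplication by [c]. *)
Lemma compress_ex c s :
  exists M : 'M[R[i]]_(comp_dim s), forall u, u *m M = comp_J s (c ** comp_V u).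
Proof.
have [h _] := comp_spec s; apply: linear_row_matrix => k u u'.
by rewrite (comp_linV h) cmulDr cmulZr (comp_linJ h).
Qed.

Definition compress c : op_family comp_pictures :=
  fun s => projT1 (cid (compress_ex c s)).

Lemma compressE c s u : u *m compress c s = comp_J s (c ** comp_V u).
Proof. exact: (projT2 (cid (compress_ex c s))). Qed.

Lemma adjm_compress c s : adjm (compress c s) = compress (cstar c) s.
Proof.
have [h _] := comp_spec s; apply/row_matrixP => k; rewrite rowE [RHS]rowE.
set w := delta_mx 0 k.
apply/eqP; rewrite -subr_eq0; apply/eqP; apply: rdot_eq0.
set u := w *m _ - _; rewrite {2}/u rdotBr -rdot_adjm !compressE.
rewrite [X in _ - X]rdot_conj !(comp_adj h) -(pf_star PF).
by rewrite !cstarM !cstarK cmulA subrr.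
Qed.

Lemma compress_lim c : strong_lim ((compress c, c) : op_family comp_pictures * A).
Proof.
have FF := superlists_proper.
move=> v e e0; apply: filterS (superlists_mem v) => s /= vs.
have [h cap] := comp_spec s.
by rewrite compressE -(comp_mul_captured PF h c (cap _ vs)) subrr rnorm0 ltW.
Qed.

Lemma compress_strong c : strong_pair ((compress c, c) : op_family comp_pictures * A).
Proof.
split; [|exact: compress_lim|].
- exists (nrm c); first exact: nrm_ge0.
  move=> s u; rewrite /= compressE; have [h _] := comp_spec s.
  rewrite (le_trans (comp_J_norm _ _))// (le_trans (pf_norm_contract _ _))//.
  rewrite ler_wpM2l ?nrm_ge0//.
  rewrite -ler_sqr ?nnegrE ?rnorm_ge0 ?pf_norm_ge0//.
  by rewrite -C_le -rdot_rnorm -pf_normE -(comp_adj h) (comp_JV h).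
- rewrite (_ : pstar _ = (compress (cstar c), cstar c)); first exact: compress_lim.
  by congr (_, _); apply: op_familyP => s; exact: adjm_compress.
Qed.

Lemma strong_limit_surj c : exists b : strong_alg comp_pictures, strong_limit b = c.
Proof. by exists (strong_of (compress_strong c)). Qed.

(** A family of zero matrices can converge to [x] only if [x] acts as zero:
    [J (x y)] then tends to zero, while its length is eventually that of
    [x y]. *)
Lemma strong_limit_kernel (b : strong_alg comp_pictures) y :
  (forall s, (val b).1 s = 0) -> pf_norm (strong_limit b ** y) = 0.
Proof.
move=> b0; set x := strong_limit b ** y.
have [_ lb _] := strongP b.
apply/eqP; rewrite eq_le pf_norm_ge0 andbT; apply/ler_addgt0Pr => e e0; rewrite add0r.
have FF := superlists_proper.
have [s [/= h1 h2]] := filter_ex (filterI (lb y _ e0) (superlists_mem x)).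
have [_ cap] := comp_spec s.
move: h1; rewrite b0 mulmx0 sub0r rnormN; apply: le_trans.
rewrite -ler_sqr ?nnegrE ?rnorm_ge0 ?pf_norm_ge0//.
by rewrite -C_le -rdot_rnorm -pf_normE -cap.
Qed.

End CompressionPictures.

Theorem theorem5p4 (R : realType) (A : cstarAlgType R) (sepA : separable A)
    (wpA : weakly_projective_unital A) :
  residually_finite_dimensional A.
Proof.
move=> a aN0.
have [F [y [PF Fy]]] : exists (F : unitization A -> R[i]) y,
    positive_functional F /\ F (cstar (unit_inj a ** y) ** (unit_inj a ** y)) != 0.
  apply: positive_functional_separates.
  by apply: contra_neq aN0; exact: unit_inj_eq0.
have [_ wp] := wpA.
have [phi_ [hphi cphi]] := wp (strong_alg (comp_pictures PF)) (unitization A)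
  (@unit_inj R A) (@strong_limit R _ _) (unit_inj_star_hom A)
  (strong_limit_hom _) (strong_limit_surj PF).
set q := pf_norm F (unit_inj a ** y).
have q0 : 0 < q.
  rewrite lt_neqAle pf_norm_ge0 andbT eq_sym; apply: contra_neq Fy => e.
  by rewrite pf_normE// -/q e expr0n.
(* Below [q / 2] the parallelogram law excludes that the limit kills [y]. *)
have [n hn] : exists n,
    nrm (strong_limit (phi_ n a) - unit_inj a) * pf_norm F y < q / 2.
  pose e := q / 2 / (pf_norm F y + 1).
  have p1 : 0 < pf_norm F y + 1 by rewrite ltr_wpDl// pf_norm_ge0.
  have e0 : 0 < e by rewrite !divr_gt0.
  have /cvgrPdist_lt/(_ e%:C) := cphi a; rewrite C_lt => /(_ e0)[n _ /(_ n (leqnn n))].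
  rewrite /= sub0r normrN normr_id nrmE C_lt => h; exists n.
  rewrite (le_lt_trans (ler_wpM2r (pf_norm_ge0 _ _) (ltW h)))// /e.
  by rewrite mulrAC ltr_pdivrMr// ltr_pM2l ?divr_gt0// ltrDl ltr01.
have [s Ts] : exists s, (val (phi_ n a)).1 s != 0.
  apply: contrapT => /forallNP h.
  have b0 s : (val (phi_ n a)).1 s = 0 by apply/eqP/negPn/negP; exact: h.
  have := pf_normB_le PF (unit_inj a ** y) (strong_limit (phi_ n a) ** y).
  rewrite strong_limit_kernel// expr0n addr0 -cmulBl -/q.
  have := pf_norm_contract PF (unit_inj a - strong_limit (phi_ n a)) y.
  rewrite nrmB; set d := pf_norm F _ => h1.
  have d0 : 0 <= d := pf_norm_ge0 _ _.
  have : d ^+ 2 < (q / 2) ^+ 2.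
    by rewrite ltr_sqr ?nnegrE ?divr_ge0 ?(ltW q0)// (le_lt_trans h1).
  rewrite expr_div_n; have : 0 < q ^+ 2 by rewrite exprn_gt0.
  lra.
exists 'rV[R[i]]_(comp_dim PF s), (row_dot R _), (fun b => strong_coord s (phi_ n b)).
split; first exact: (strong_coord_rep s (hphi n)).
apply: contra_neq Ts => /lfunP h; apply/row_matrixP => k.
by rewrite rowE -strong_coordE h lfunE row0.
Qed.
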